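(* Let $(a_k)_{k\ge 0}$ be the Stirling coefficients, i.e. the coefficients in the asymptotic expansion $n! \sim n^n e^{-n}\sqrt{2\pi n}\,\sum_{k\ge 0} \frac{a_k}{n^k}$ as $n\to\infty$. Then for every integer $k\ge 0$, $$a_k = \frac{(2k)!}{2^k k!}\sum_{i=0}^{2k} \binom{k+i-1/2}{i}\binom{3k+1/2}{2k-i}2^{i}\sum_{j=0}^{i}\binom{i}{j}(-1)^j j!\,\frac{S(2k+i+j,j)}{(2k+i+j)!},$$ where $S(p,q)$ denotes the Stirling numbers of the second kind.
   Context: The Stirling coefficients $a_k$ are the (uniquely determined) real numbers such that, for every integer $N\ge 0$, $\frac{n!}{n^n e^{-n}\sqrt{2\pi n}} = \sum_{k=0}^{N}\frac{a_k}{n^k} + O\!\left(n^{-N-1}\right)$ as $n\to\infty$ through positive integers. For real $x$ and integer $m\ge 0$, $\binom{x}{m}=\frac{x(x-1)\cdots(x-m+1)}{m!}$ is the generalized binomial coefficient (equal to $1$ for $m=0$). $S(p,q)$ is the number of partitions of a set of $p$ elements into $q$ nonempty blocks, with $S(0,0)=1$ and $S(p,0)=0$ for $p\ge 1$. *)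

(* Defs.v *)
From mathcomp Require Import all_boot all_order all_algebra.
From mathcomp Require Import all_classical all_reals all_analysis.

Set Implicit Arguments.
Unset Strict Implicit.
Unset Printing Implicit Defensive.

Import Order.TTheory GRing.Theory Num.Theory.
Import numFieldNormedType.Exports.

Local Open Scope ring_scope.

(* [finset.partition] requires nonempty blocks; the unqualified name is the one
   of classical_sets. *)
Definition stirling2 (p q : nat) : nat :=
  #|[set P : {set {set 'I_p}} |
       finset.partition P [set: 'I_p] & #|P| == q]%SET|.

Definition gbinom (R : realType) (x : R) (m : nat) : R :=
  (\prod_(i < m) (x - i%:R)) / m`!%:R.

Definition stirling_ratio (R : realType) (n : nat) : R :=
  n`!%:R / (n%:R ^+ n * expR (- n%:R) * Num.sqrt (2 * pi * n%:R)).

Local Open Scope classical_set_scope.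

(* The junk values at n = 0 (division by 0) are irrelevant: the filter [\oo]
   only sees large n. *)
Definition stirling_coefficients (R : realType) (a : nat -> R) : Prop :=
  forall N : nat,
    (fun n : nat => stirling_ratio R n - \sum_(k < N.+1) a k / n%:R ^+ k)
      =O_\oo (fun n : nat => (n%:R : R) ^- N.+1).

(* Main.v *)
Require Import Defs.
From mathcomp Require Import all_boot all_order all_algebra.
From mathcomp Require Import all_classical all_reals all_analysis.
From mathcomp Require Import ring lra zify.

Import Order.TTheory GRing.Theory Num.Theory.
Import numFieldNormedType.Exports.

Local Open Scope ring_scope.

(* Write [z = 1 / n]. The formula of the theorem is
   [b_k = (2k)! / (2^k k!) * [x^(2k)] g^(-(k+1/2))] with
   [g = 2 (exp x - 1 - x) / x^2]: expand the binomial series of [g^(-(k+1/2))] at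
   [g = 1] in powers of [g], and read the Stirling numbers off the powers of
   [exp x - 1]. This is Laplace's method applied to
   [sqrt (n / 2 pi) * int exp (- n (exp x - 1 - x)) dx], which is the Stirling
   ratio [r n]. No integral is needed, however. The linear forms
   [LX k F = (2k)! / (2^k k!) * [x^(2k)] (F * g^(-(k+1/2)))] satisfy the formal
   integration by parts [LX k F' = LX (k+1) ((exp x - 1) F)]; this yields, for
   [B z = sum_k b_k z^k], the functional equation [B (1/(n+1)) = rho n * B (1/n)]
   up to any order, where [rho n = r (n+1) / r n]. Comparing with the expansion
   of [r], which satisfies the same equation, the coefficients agree as soon as
   [a_0 = b_0 = 1]; the latter is Wallis' product together with a positive
   lower bound of [r]. *)

(** * Stirling numbers of the second kind *)

Section SetPartitionCounting.
Set Implicit Arguments.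
Unset Strict Implicit.
Local Open Scope nat_scope.

(* An injection of the blocks of [P] into ['I_q] is the same as a function
   whose fibres are the blocks of [P]. *)
Lemma card_preim_partition (T : finType) (P : {set {set T}}) (q : nat) :
  finset.partition P [set: T]%SET ->
  #|[set f : {ffun T -> 'I_q} | preim_partition f [set: T]%SET == P]%SET|
    = q ^_ #|P|.
Proof.
move=> partP; have [/eqP covP tiP /negP P0] := and3P partP.
have blP x : finset.pblock P x \in P by rewrite finset.pblock_mem // covP inE.
pose D := {B : {set T} | B \in P}.
pose bl x : D := exist _ (finset.pblock P x) (blP x).
have repP (B : D) : exists x, bl x == B.
  case: B => B BP; have [B0|[x xB]] := set_0Vmem B.
    by case: P0; rewrite -B0.
  by exists x; apply/eqP/val_inj; exact: def_pblock tiP BP xB.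
pose Phi (h : {ffun D -> 'I_q}) : {ffun T -> 'I_q} := [ffun x => h (bl x)].
have Phi_inj : injective Phi.
  move=> h1 h2 /ffunP h12; apply/ffunP => B; have [x /eqP <-] := repP B.
  by have := h12 x; rewrite !ffunE.
have blE x y : (y \in finset.pblock P x) = (bl x == bl y).
  rewrite -(inj_eq val_inj) /= eq_pblock //.
  by rewrite covP inE.
have PE := equivalence_partition_pblock partP.
rewrite -[X in q ^_ X](card_sig [in P]) -[q in LHS]card_ord.
rewrite -[q in RHS]card_ord -card_inj_ffuns -(card_imset _ Phi_inj).
rewrite !card_ord; congr #|pred_of_set _|; apply/setP => f; rewrite inE.
apply/eqP/imsetP => [fP|[h]].
  have fE x y : (y \in finset.pblock P x) = (f x == f y).
    rewrite -fP pblock_equivalence_partition ?inE //.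
    by split=> // /eqP->.
  (* By [fE] the function [f] is constant on each block and separates distinct blocks, so its values
     at chosen representatives give the injection. *)
  exists [ffun B => f (xchoose (repP B))].
    rewrite inE; apply/injectiveP => B1 B2; rewrite !ffunE => /eqP.
    rewrite -fE blE => /eqP.
    by rewrite (eqP (xchooseP (repP B1))) (eqP (xchooseP (repP B2))).
  apply/ffunP => x; rewrite !ffunE.
  have := xchooseP (repP (bl x)); rewrite eq_sym -blE fE.
  by move/eqP.
rewrite inE => /injectiveP hi ->; rewrite -[RHS]PE /preim_partition.
congr (equivalence_partition _ _).
by apply/funext => x; apply/funext => y /=; rewrite !ffunE blE (inj_eq hi).
Qed.

(** Sort the functions from ['I_p] to ['I_q] by their partition into fibres; [card_preim_partition]
    counts the functions over each partition. *)
Lemma expn_stirling2 (p q : nat) :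
  q ^ p = \sum_(j < q.+1) stirling2 p j * q ^_ j.
Proof.
rewrite -[q in LHS](card_ord q) -[p in LHS](card_ord p) -card_ffun -sum1_card.
rewrite (partition_big (fun f : {ffun 'I_p -> 'I_q} => preim_partition f [set: 'I_p]%SET)
  (fun P => finset.partition P [set: 'I_p]%SET)) /=; last first.
  by move=> f _; exact: preim_partitionP.
transitivity (\sum_(P : {set {set 'I_p}} | finset.partition P [set: 'I_p]%SET)
   q ^_ #|P|).
  apply: eq_bigr => P partP; rewrite -(@card_preim_partition _ _ q partP).
  by rewrite -sum1_card; apply: eq_bigl => f; rewrite inE.
rewrite (bigID (fun P : {set {set 'I_p}} => #|P| < q.+1)) /= addnC big1 ?add0n; last first.
  by move=> P /andP[_]; rewrite -leqNgt => qP; rewrite ffact_small.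
rewrite (partition_big (fun P : {set {set 'I_p}} => inord #|P| : 'I_q.+1) xpredT) //=.
apply: eq_bigr => j _; rewrite /stirling2 -sum1_card big_distrl /=.
apply: eq_big => [P|P].
  rewrite inE; apply/andP/andP => [[/andP[-> lt]] /eqP <-|[-> /eqP Pj]].
    by rewrite inordK.
  rewrite Pj ltn_ord; split=> //; apply/eqP/val_inj; rewrite /= inordK //.
by case/andP => /andP[_ lt] /eqP <-; rewrite inordK // mul1n.
Qed.

End SetPartitionCounting.

(** * Truncated power series *)

Section PolynomialCongruence.
Set Implicit Arguments.
Unset Strict Implicit.
Variable R : realType.
Implicit Types p q r : {poly R}.

(** Formal power series are represented by polynomials, compared modulo ['X^m]. *)
Definition eqmodX (m : nat) p q := exists r, p = q + r * 'X^m.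

Lemma eqmodX_refl m p : eqmodX m p p.
Proof. by exists 0; rewrite mul0r addr0. Qed.

Lemma eqmodX_sym m p q : eqmodX m p q -> eqmodX m q p.
Proof. by move=> [r ->]; exists (- r); ring. Qed.

Lemma eqmodX_trans m p q r : eqmodX m p q -> eqmodX m q r -> eqmodX m p r.
Proof. by move=> [s ->] [t ->]; exists (s + t); ring. Qed.

Lemma eqmodX_leq m n p q : (n <= m)%N -> eqmodX m p q -> eqmodX n p q.
Proof.
move=> nm [r ->]; exists (r * 'X^(m - n)).
by rewrite -mulrA -exprD subnK.
Qed.

Lemma eqmodXD m p1 q1 p2 q2 :
  eqmodX m p1 q1 -> eqmodX m p2 q2 -> eqmodX m (p1 + p2) (q1 + q2).
Proof. by move=> [s ->] [t ->]; exists (s + t); ring. Qed.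

Lemma eqmodXM m p1 q1 p2 q2 :
  eqmodX m p1 q1 -> eqmodX m p2 q2 -> eqmodX m (p1 * p2) (q1 * q2).
Proof.
by move=> [s ->] [t ->]; exists (s * q2 + q1 * t + s * t * 'X^m); ring.
Qed.

Lemma eqmodXZ m c p q : eqmodX m p q -> eqmodX m (c *: p) (c *: q).
Proof. by move=> pq; rewrite -!mul_polyC; apply: eqmodXM => //; exact: eqmodX_refl. Qed.

Lemma eqmodXMn m n p q : eqmodX m p q -> eqmodX m (p *+ n) (q *+ n).
Proof. by move=> [r ->]; exists (r *+ n); rewrite mulrnDl mulrnAl. Qed.

Lemma eqmodX_sum m n (F G : nat -> {poly R}) :
  (forall i, (i < n)%N -> eqmodX m (F i) (G i)) ->
  eqmodX m (\sum_(i < n) F i) (\sum_(i < n) G i).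
Proof.
elim: n => [|n IH] FG; first by rewrite !big_ord0; exact: eqmodX_refl.
rewrite !big_ord_recr /=; apply: eqmodXD; last exact: FG.
by apply: IH => i ilt; apply: FG; rewrite ltnS ltnW.
Qed.

Lemma eqmodX_sum0 m n (F : nat -> {poly R}) :
  (forall i, (i < n)%N -> eqmodX m (F i) 0) -> eqmodX m (\sum_(i < n) F i) 0.
Proof. by move=> F0; have := eqmodX_sum F0; rewrite [X in eqmodX _ _ X]big1. Qed.

Lemma eqmodX_coef m p q i : eqmodX m p q -> (i < m)%N -> p`_i = q`_i.
Proof. by move=> [r ->] im; rewrite coefD coefMXn im addr0. Qed.

Lemma coef_eqmodX m p q : (forall i, (i < m)%N -> p`_i = q`_i) -> eqmodX m p q.
Proof.
move=> pq; exists (drop_poly m (p - q)).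
have t0 : take_poly m (p - q) = 0.
  apply/polyP => i; rewrite coef_take_poly coef0; case: ltnP => // im.
  by rewrite coefB pq // subrr.
have := poly_take_drop m (p - q); rewrite t0 add0r => ->; ring.
Qed.

End PolynomialCongruence.

(** * The truncated exponential and the generating function of the Stirling numbers *)

Section TruncatedExponential.
Set Implicit Arguments.
Unset Strict Implicit.
Variable R : realType.

Lemma factR_neq0 n : n`!%:R != 0 :> R.
Proof. by rewrite pnatr_eq0 -lt0n fact_gt0. Qed.

Definition expX (M : nat) : {poly R} := \poly_(i < M.+1) (i`!%:R)^-1.

Lemma coef_expX M i : (i <= M)%N -> (expX M)`_i = (i`!%:R)^-1.
Proof. by move=> iM; rewrite coef_poly ltnS iM. Qed.

Lemma deriv_expX M : (expX M)^`() = expX M - (M`!%:R)^-1 *: 'X^M.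
Proof.
apply/polyP => i; rewrite coef_deriv coefB coefZ coefXn !coef_poly ltnS.
case: (ltngtP i M) => [iM|Mi|->].
- rewrite ltnS (ltnW iM) mulr0 subr0 factS natrM -mulr_natl.
  by field; rewrite factR_neq0 nat1r pnatr_eq0.
- by rewrite ltnS leqNgt Mi mul0rn mulr0 subr0.
- by rewrite ltnSn mulr1 subrr mul0rn.
Qed.

(** This is [(exp x)^q = exp (q x)] below the truncation order; the induction step is the binomial
    expansion of [(1 + q)^p]. *)
Lemma coef_expX_pow M q p : (p <= M)%N ->
  (expX M ^+ q)`_p = q%:R ^+ p / p`!%:R.
Proof.
elim: q p => [|q IH] p pM.
  rewrite expr0 coef1 expr0n; case: p {pM} => [|p] /=; rewrite ?mul0r //.
  by rewrite fact0 divr1.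
rewrite exprSr coefM -(nat1r q) exprDn mulr_suml; apply: eq_bigr => i _.
have ip : (i <= p)%N by rewrite -ltnS.
rewrite IH ?(leq_trans ip pM) // coef_expX ?(leq_trans (leq_subr _ _) pM) //.
rewrite expr1n mul1r -mulr_natr -(bin_fact ip) !natrM.
have b0 : 'C(p, i)%:R != 0 :> R by rewrite pnatr_eq0 -lt0n bin_gt0.
by field; rewrite b0 !factR_neq0.
Qed.

(** Expand [q ^ p / p!] twice: by the binomial theorem for [(1 + (exp x - 1)) ^ q], and by
    [expn_stirling2]. By strong induction the terms below the top one agree, hence so do the top
    ones. *)
Lemma coef_expX_sub1_pow M j p : (p <= M)%N ->
  ((expX M - 1) ^+ j)`_p = j`!%:R * (stirling2 p j)%:R / p`!%:R.
Proof.
move=> pM; elim/ltn_ind: j => q IH.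
have := @coef_expX_pow M q p pM.
rewrite -[expX M in LHS](subrK 1) [_ - 1 + 1]addrC exprDn coef_sum -natrX.
rewrite expn_stirling2 natr_sum mulr_suml !big_ord_recr /= ffactnn.
rewrite subnn expr0 mul1r binn mulr1n.
rewrite (eq_bigr (fun j : 'I_q => (stirling2 p j * q ^_ j)%:R / p`!%:R)).
  by rewrite natrM [_%:R * _]mulrC => /addrI.
move=> j _; rewrite expr1n mul1r coefMn IH // -mulr_natl -bin_ffact !natrM.
by ring.
Qed.

End TruncatedExponential.

(** * Generalized binomial coefficients *)

Section GeneralizedBinomial.
Set Implicit Arguments.
Unset Strict Implicit.
Variable R : realType.
Implicit Types x : R.

Lemma gbinom0 x : gbinom x 0 = 1.
Proof. by rewrite /gbinom big_ord0 fact0 divr1. Qed.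

Lemma gbinom_recr x m :
  m.+1%:R * gbinom x m.+1 = (x - m%:R) * gbinom x m.
Proof.
rewrite /gbinom big_ord_recr /= factS natrM.
by field; rewrite factR_neq0 nat1r pnatr_eq0.
Qed.

Lemma gbinom_recl x m : m.+1%:R * gbinom x m.+1 = x * gbinom (x - 1) m.
Proof.
rewrite /gbinom big_ord_recl /= factS natrM subr0.
under eq_bigr => i _ do rewrite /bump leq0n /= natrD opprD addrA.
by field; rewrite factR_neq0 nat1r pnatr_eq0.
Qed.

Lemma gbinom_pascal x m :
  gbinom x m.+1 = gbinom (x - 1) m.+1 + gbinom (x - 1) m.
Proof.
have m0 : m.+1%:R != 0 :> R by rewrite pnatr_eq0.
apply: (mulfI m0); rewrite mulrDr gbinom_recl gbinom_recr -natr1; ring.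
Qed.

Lemma gbinomD x n m :
  gbinom x (n + m) * (n + m)`!%:R =
  (gbinom x n * n`!%:R) * (gbinom (x - n%:R) m * m`!%:R).
Proof.
rewrite /gbinom !divfK ?factR_neq0 // big_split_ord /=; congr (_ * _).
by apply: eq_bigr => i _; rewrite natrD opprD addrA.
Qed.

Lemma gbinomN x m : gbinom (- x) m = (-1) ^+ m * gbinom (x + m%:R - 1) m.
Proof.
elim: m => [|m IH]; first by rewrite !gbinom0 mulr1.
have m0 : m.+1%:R != 0 :> R by rewrite pnatr_eq0.
apply: (mulfI m0); rewrite gbinom_recr IH [RHS]mulrCA gbinom_recl -natr1 exprS.
have -> : x + (m%:R + 1) - 1 - 1 = x + m%:R - 1 :> R by ring.
ring.
Qed.

(** Multiplied by [i! (n + 1 - i)!], both sides become the falling factorial of [x + n] of length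
    [n + 1]. *)
Lemma gbinom_mul_bin x n i : (i <= n.+1)%N ->
  gbinom (x + i%:R - 1) i * gbinom (x + n%:R) (n.+1 - i) =
  gbinom (x + n%:R) n.+1 * 'C(n.+1, i)%:R.
Proof.
move=> i_n; have := gbinomD (x + n%:R) (n.+1 - i) i.
rewrite subnK // natrB // -natr1 -(bin_fact i_n) !natrM.
have -> : x + n%:R - (n%:R + 1 - i%:R) = x + i%:R - 1 :> R by ring.
move=> H; apply: (mulIf (factR_neq0 R i)); apply: (mulIf (factR_neq0 R (n.+1 - i))).
by rewrite -[RHS]mulrA -[RHS]mulrA H; ring.
Qed.

(* The truncation of the binomial series of [G ^ (-x)] at [G = 1], expanded in
   powers of [G]. *)
Lemma binomial_series_trunc x (G : {poly R}) n :
  \sum_(m < n.+1) gbinom (- x) m *: (G - 1) ^+ m =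
  \sum_(i < n.+1) (gbinom (x + i%:R - 1) i * gbinom (x + n%:R) (n - i)) *:
     (- G) ^+ i.
Proof.
elim: n => [|n IH]; first by rewrite !big_ord1 !gbinom0 !mulr1.
rewrite big_ord_recr /= IH [in RHS]big_ord_recr /= subnn gbinom0 mulr1.
have -> : gbinom (- x) n.+1 *: (G - 1) ^+ n.+1 = \sum_(i < n.+2)
  (gbinom (x + i%:R - 1) i * gbinom (x + n%:R) (n.+1 - i)) *: (- G) ^+ i.
  have -> : G - 1 = (-1)%:P * (1 + - G) by rewrite polyCN; ring.
  rewrite exprMn exprDn -mul_polyC -rmorphXn mulrA -rmorphM gbinomN.
  rewrite [_ * (-1) ^+ _]mulrC mulrA -expr2 -exprM mulnC exprM sqrrN expr1n expr1n.
  have -> : x + n.+1%:R - 1 = x + n%:R :> R by rewrite -natr1; ring.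
  rewrite mul1r mul_polyC scaler_sumr; apply: eq_bigr => i _.
  rewrite expr1n mul1r -[_ *+ 'C(_, _)]scaler_nat scalerA.
  by rewrite gbinom_mul_bin // -ltnS.
rewrite [X in _ + X]big_ord_recr /= subnn gbinom0 mulr1 addrA -big_split /=; congr (_ + _).
apply: eq_bigr => i _; rewrite -scalerDl -mulrDr; congr ((_ * _) *: _).
rewrite subSn -1?ltnS // (gbinom_pascal (x + n.+1%:R)) addrC.
by have -> : x + n.+1%:R - 1 = x + n%:R :> R by rewrite -natr1; ring.
Qed.

End GeneralizedBinomial.

(** * The formal saddle point method *)

Section FormalSaddlePoint.
Set Implicit Arguments.
Unset Strict Implicit.
Variables (R : realType) (M : nat).
Hypothesis M_gt1 : (1 < M)%N.

Local Notation y := (expX R M - 1).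

(** The number of terms is chosen so that [mulX2_gX] is an exact identity and not only a
    congruence. *)
Definition gX : {poly R} := \poly_(i < M.-1) (2 / i.+2`!%:R).

Lemma mulX2_gX : 'X^2 * gX = 2 *: (y - 'X).
Proof.
apply/polyP => i; rewrite coefXnM coefZ !coefB coef1 coefX.
case: i => [|[|i]] /=.
- by rewrite coef_expX // fact0 invr1; ring.
- by rewrite coef_expX ?(ltnW M_gt1) // invr1; ring.
- rewrite subn2 /= /expX /gX !coef_poly !subr0.
  have -> : (i.+2 < M.+1)%N = (i < M.-1)%N by lia.
  by case: ifP => // _; rewrite mulr0.
Qed.

Lemma gX_sub1 : exists h, gX - 1 = h * 'X.
Proof.
suff : eqmodX 1 gX 1 by case=> h ->; exists h; rewrite expr1; ring.
apply: coef_eqmodX => -[|//] _; rewrite coef_poly coef1.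
have -> : (0 < M.-1)%N by lia.
by rewrite divff.
Qed.

Lemma eqmodX_gX_sub1_pow n m : (n <= m)%N -> eqmodX n ((gX - 1) ^+ m) 0.
Proof.
move=> nm; apply: (@eqmodX_leq _ m) => //; case: gX_sub1 => h ->.
by exists (h ^+ m); rewrite exprMn add0r.
Qed.

(* The binomial series of [gX ^ (- (k + 1/2))]. *)
Definition WX (k : nat) : {poly R} :=
  \sum_(m < M.+1) gbinom (- (k%:R + 1 / 2)) m *: (gX - 1) ^+ m.

(** Write [gX = (gX - 1) + 1] and collect by Pascal's rule. Only the top term, a multiple of
    [(gX - 1) ^+ M.+1], is left over, and it is divisible by ['X^M]. *)
Lemma WX_mul_gX k : eqmodX M (WX k.+1 * gX) (WX k).
Proof.
pose x : R := - (k%:R + 1 / 2).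
have xE : - (k.+1%:R + 1 / 2) = x - 1 by rewrite /x -natr1; ring.
have -> : WX k.+1 * gX = WX k + gbinom (x - 1) M *: (gX - 1) ^+ M.+1.
  have Wu : WX k.+1 * (gX - 1) = \sum_(m < M) gbinom (x - 1) m *: (gX - 1) ^+ m.+1
      + gbinom (x - 1) M *: (gX - 1) ^+ M.+1.
    rewrite /WX xE mulr_suml big_ord_recr /= -scalerAl -exprSr; congr (_ + _).
    by apply: eq_bigr => i _; rewrite -scalerAl -exprSr.
  have W1 : WX k.+1 = 1 + \sum_(m < M) gbinom (x - 1) m.+1 *: (gX - 1) ^+ m.+1.
    by rewrite /WX xE big_ord_recl gbinom0 scale1r.
  have -> : WX k = 1 + (\sum_(m < M) gbinom (x - 1) m.+1 *: (gX - 1) ^+ m.+1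
      + \sum_(m < M) gbinom (x - 1) m *: (gX - 1) ^+ m.+1).
    rewrite /WX -/x big_ord_recl gbinom0 scale1r; congr (_ + _).
    rewrite -big_split /=; apply: eq_bigr => i _.
    by rewrite -scalerDl -gbinom_pascal.
  have -> : WX k.+1 * gX = WX k.+1 * (gX - 1) + WX k.+1 by ring.
  rewrite Wu W1; ring.
rewrite -[X in eqmodX _ _ X]addr0; apply: eqmodXD; first exact: eqmodX_refl.
rewrite -[X in eqmodX _ _ X](scaler0 _ (gbinom (x - 1) M)); apply: eqmodXZ.
exact: eqmodX_gX_sub1_pow.
Qed.

(** The power rule for [gX ^ (- (k + 1/2))], obtained by termwise differentiation; the truncations
    differ by a multiple of [(gX - 1) ^+ M]. *)
Lemma deriv_WX k : eqmodX M ((WX k)^`()) (- (k%:R + 1 / 2) *: (gX^`() * WX k.+1)).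
Proof.
pose x : R := - (k%:R + 1 / 2).
have xE : - (k.+1%:R + 1 / 2) = x - 1 by rewrite /x -natr1; ring.
have -> : (WX k)^`() = x *: (gX^`() * \sum_(m < M) gbinom (x - 1) m *: (gX - 1) ^+ m).
  rewrite /WX raddf_sum big_ord_recl /= expr0 derivZ derivC scaler0 add0r.
  rewrite mulr_sumr scaler_sumr; apply: eq_bigr => i _.
  rewrite derivZ deriv_exp derivB derivC subr0 -scalerAr scalerA -gbinom_recl.
  by rewrite /= -[(_ * _) *+ _]scaler_nat scalerA mulrC.
rewrite -/x /WX xE; apply: eqmodXZ; apply: eqmodXM; first exact: eqmodX_refl.
rewrite big_ord_recr /= -[X in eqmodX _ X]addr0; apply: eqmodXD.
  exact: eqmodX_refl.
apply: eqmodX_sym; rewrite -[X in eqmodX _ _ X](scaler0 _ (gbinom (x - 1) M)).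
by apply: eqmodXZ; exact: eqmodX_gX_sub1_pow.
Qed.

End FormalSaddlePoint.

Section OddFactorial.
Set Implicit Arguments.
Unset Strict Implicit.
Variable R : realType.

(** This is [(2k - 1)!!], the moment of order [2k] of the standard normal law. *)
Definition oddfact (k : nat) : R := (2 * k)`!%:R / (2 ^+ k * k`!%:R).

Lemma oddfactS k : oddfact k.+1 = (2 * k).+1%:R * oddfact k.
Proof.
rewrite /oddfact mulnS !add2n !factS !natrM exprS.
field; rewrite factR_neq0 expf_neq0 //=.
Qed.

Lemma gbinom_oddfact i j :
  gbinom (- (i%:R + 1 / 2) : R) j * j`!%:R * 2 ^+ j * oddfact i =
  (-1) ^+ j * oddfact (i + j).
Proof.
elim: j => [|j IH]; first by rewrite gbinom0 addn0 !mulr1.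
rewrite factS natrM [gbinom _ _ * _]mulrA [gbinom _ _ * _]mulrC gbinom_recr.
rewrite addnS oddfactS !exprS.
transitivity (2 * (- (i%:R + 1 / 2) - j%:R) * ((-1) ^+ j * oddfact (i + j))).
  by rewrite -IH; ring.
by rewrite -[(2 * _).+1%:R]natr1 natrM natrD; field.
Qed.

End OddFactorial.

(** * The linear forms [LX] and formal integration by parts *)

Section FormalIntegral.
Set Implicit Arguments.
Unset Strict Implicit.
Variables (R : realType) (M : nat).
Hypothesis M_gt1 : (1 < M)%N.

Local Notation e := (expX R M).
Local Notation y := (expX R M - 1).

(* The coefficient of [n ^ (-k)] in the asymptotic expansion of
   [sqrt (n / 2 pi) * int F x * expR (- n * (expR x - 1 - x)) dx]. *)
Definition LX (k : nat) (F : {poly R}) : R := oddfact R k * (F * WX R M k)`_(2 * k).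

Lemma LXD k F G : LX k (F + G) = LX k F + LX k G.
Proof. by rewrite /LX mulrDl coefD mulrDr. Qed.

Lemma LXZ k c F : LX k (c *: F) = c * LX k F.
Proof. by rewrite /LX -mul_polyC -[_%:P * _ * _]mulrA coefCM mulrCA. Qed.

Lemma LX_sum k n (F : nat -> {poly R}) :
  LX k (\sum_(i < n) F i) = \sum_(i < n) LX k (F i).
Proof. by rewrite /LX mulr_suml coef_sum mulr_sumr. Qed.

Lemma LX_eqmodX k m F G : (2 * k < m)%N -> eqmodX m F G -> LX k F = LX k G.
Proof.
move=> km FG; rewrite /LX; congr (_ * _).
by apply: (eqmodX_coef (m := m)) => //; apply: eqmodXM => //; exact: eqmodX_refl.
Qed.

(* Integration by parts: [F' * w] and [n * (expR x - 1) * F * w] have the same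
   integral when [w = expR (- n * (expR x - 1 - x))]. *)
Lemma LX_deriv k F : ((2 * k).+2 < M)%N -> LX k F^`() = LX k.+1 (y * F).
Proof.
move=> kM; suff H : (F^`() * WX R M k)`_(2 * k)
    = (2 * k).+1%:R * (y * F * WX R M k.+1)`_(2 * k.+1).
  by rewrite /LX oddfactS H; ring.
set P := F * WX R M k.+1.
(* Differentiating [mulX2_gX] gives [y = 'X * g + 'X^2 * g' / 2 + 'X^M / M!]. The last term lies
   beyond the degree [2k + 2] that is read off. *)
have -> : y * F * WX R M k.+1 = P * gX R M * 'X + 2^-1 *: (P * (gX R M)^`() * 'X^2)
    + (M`!%:R^-1 *: P) * 'X^M.
  have := congr1 (@deriv R) (mulX2_gX R M_gt1).
  rewrite derivM derivZ derivXn !derivB derivC derivX deriv_expX subr0 => H.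
  have -> : y * F * WX R M k.+1 = P * y by rewrite /P; ring.
  have -> : y = 2^-1 *: (2 *: (y - M`!%:R^-1 *: 'X^M)) + M`!%:R^-1 *: 'X^M.
    by rewrite scalerA mulVf // scale1r subrK.
  have -> : 2 *: (y - M`!%:R^-1 *: 'X^M) = 'X^(2.-1) *+ 2 * gX R M + 'X^2 * (gX R M)^`().
    by rewrite H; congr (_ *: _); ring.
  rewrite -!mul_polyC /=.
  have h : (2^-1 : R)%:P * 2 = 1 by rewrite -polyC_natr -polyCM mulVf.
  rewrite mulrDr mulrDr expr1.
  transitivity (P * ((2^-1 : R)%:P * 2) * 'X * gX R M
    + (2^-1 : R)%:P * (P * (gX R M)^`() * 'X^2) + (M`!%:R^-1)%:P * P * 'X^M).
    by ring.
  by rewrite h; ring.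
rewrite !coefD coefMXn mulnS add2n kM addr0 coefMX /= coefZ coefMXn /= subn2 /=.
(* After the product rule, [WX_mul_gX] and [deriv_WX] express both terms through [P]; the factor
   [k + 1/2], half of [2k + 1], matches the [2^-1] above. *)
have -> : F^`() * WX R M k = (F * WX R M k)^`() - F * (WX R M k)^`().
  by rewrite derivM; ring.
rewrite coefB coef_deriv.
have kM1 : ((2 * k).+1 < M)%N by lia.
have kM0 : ((2 * k) < M)%N by lia.
rewrite (eqmodX_coef (eqmodXM (eqmodX_refl M F) (deriv_WX R M_gt1 k)) kM0).
rewrite (eqmodX_coef (eqmodXM (eqmodX_refl M F) (eqmodX_sym (WX_mul_gX R M_gt1 k))) kM1).
rewrite -mul_polyC [F * (_%:P * _)]mulrCA coefCM.
have -> : F * (WX R M k.+1 * gX R M) = P * gX R M by rewrite /P; ring.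
have -> : F * ((gX R M)^`() * WX R M k.+1) = P * (gX R M)^`() by rewrite /P; ring.
by rewrite -mulr_natr -[(2 * _).+1%:R]natr1 natrM; field.
Qed.

(** Since [(y - 'X)^j] is ['X^(2j) * g^j / 2^j], it lowers the degree by [2j] and the index of [WX]
    by [j]; [gbinom_oddfact] adjusts the weight. Summed over [j], this describes the factor
    [exp (- (exp x - 1 - x))], that is, the passage from [n] to [n + 1]. *)
Lemma LX_phi_pow k j : (2 * k < M)%N ->
  (-1) ^+ j / j`!%:R * LX k ((y - 'X) ^+ j) =
  if (j <= k)%N then gbinom (- ((k - j)%:R + 1 / 2)) j * LX (k - j) 1 else 0.
Proof.
move=> kM.
have E : 2 ^+ j *: (y - 'X) ^+ j = 'X^(2 * j) * gX R M ^+ j.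
  by rewrite exprM -exprMn mulX2_gX // -!mul_polyC exprMn polyC_exp.
have W i : (j <= i)%N -> eqmodX M (gX R M ^+ j * WX R M i) (WX R M (i - j)).
  elim: j i {E} => [|j IH] i ji.
    by rewrite expr0 mul1r subn0; exact: eqmodX_refl.
  case: i ji => // i ji.
  rewrite exprS -mulrA mulrCA [gX R M * _]mulrC subSS.
  apply: eqmodX_trans (IH _ ji); apply: eqmodXM; first exact: eqmodX_refl.
  exact: WX_mul_gX.
have -> : LX k ((y - 'X) ^+ j) = 2 ^- j *
    (oddfact R k * ('X^(2 * j) * (gX R M ^+ j * WX R M k))`_(2 * k)).
  apply: (mulfI (expf_neq0 j (_ : 2 != 0 :> R))) => //.
  by rewrite -LXZ E [RHS]mulrA mulfV ?expf_neq0 // mul1r /LX -mulrA.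
rewrite coefXnM; case: (leqP j k) => [jk|kj]; last first.
  have -> : (2 * k < 2 * j)%N by lia.
  by rewrite !mulr0.
have -> : (2 * k < 2 * j)%N = false by lia.
have kjM : (2 * k - 2 * j < M)%N by lia.
rewrite (eqmodX_coef (W _ jk) kjM) /LX [1 * WX R M _]mul1r -mulnBr.
have := gbinom_oddfact R (k - j) j; rewrite subnK // => H.
apply: (mulIf (factR_neq0 R j)); apply: (mulIf (expf_neq0 j (_ : 2 != 0 :> R))) => //.
transitivity (((-1) ^+ j * oddfact R k) * (WX R M (k - j))`_(2 * (k - j))).
  by field; rewrite factR_neq0 expf_neq0.
by rewrite -H; ring.
Qed.

End FormalIntegral.

(** * Multiplicativity of the truncated exponential *)

Section ExponentialProduct.
Set Implicit Arguments.
Unset Strict Implicit.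
Variable R : realType.

Lemma expX_add (n : nat) (p q : {poly R}) : eqmodX 1 p 0 -> eqmodX 1 q 0 ->
  eqmodX n.+1 (\sum_(j < n.+1) j`!%:R^-1 *: (p + q) ^+ j)
    ((\sum_(j < n.+1) j`!%:R^-1 *: p ^+ j) * (\sum_(j < n.+1) j`!%:R^-1 *: q ^+ j)).
Proof.
move=> p0 q0.
(* A second variable records the exponent [j]. In [U p * U q] the coefficients up to index [n] are
   given by the binomial theorem, and one of index [i > n] is divisible by ['X^i] because [p] and
   [q] have no constant term. *)
pose U (p : {poly R}) : {poly {poly R}} := \poly_(j < n.+1) (j`!%:R^-1 *: p ^+ j).
have U1 r : (U r).[1] = \sum_(j < n.+1) j`!%:R^-1 *: r ^+ j.
  by rewrite horner_poly; apply: eq_bigr => j _; rewrite expr1n mulr1.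
have small r i : eqmodX 1 r 0 -> eqmodX i (U r)`_i 0.
  case=> s; rewrite add0r expr1 => ->; rewrite coef_poly; case: ifP => _.
    by exists (i`!%:R^-1 *: s ^+ i); rewrite add0r exprMn scalerAl.
  exact: eqmodX_refl.
rewrite -!U1 -hornerM (@horner_coef_wide _ (n.+1 + n) (U p * U q)); last first.
  have szU r : (size (U r) <= n.+1)%N by exact: size_poly.
  apply: leq_trans (size_polyMleq (U p) (U q)) _; rewrite -subn1 leq_subLR.
  by apply: leq_trans (leq_add (szU p) (szU q)) _; lia.
rewrite big_split_ord /= -[X in eqmodX _ X]addr0 U1; apply: eqmodXD.
  rewrite (_ : \sum_(j < n.+1) _ = \sum_(i < n.+1) (U p * U q)`_i * 1 ^+ i).
    exact: eqmodX_refl.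
  apply: eq_bigr => j _; rewrite expr1n mulr1 coefM addrC exprDn scaler_sumr.
  apply: eq_bigr => i _; have ij : (i <= j)%N by rewrite -ltnS.
  have jn := ltn_ord j.
  rewrite !coef_poly (leq_ltn_trans ij) // (leq_ltn_trans (leq_subr _ _)) //.
  rewrite -scalerAl -scalerAr !scalerA [q ^+ _ * _]mulrC.
  rewrite -[_ *+ 'C(j, i)]scaler_nat scalerA; congr (_ *: _).
  rewrite -(bin_fact ij) !natrM.
  have b0 : 'C(j, i)%:R != 0 :> R by rewrite pnatr_eq0 -lt0n bin_gt0.
  by field; rewrite b0 !factR_neq0.
apply/eqmodX_sym/(@eqmodX_sum0 _ n.+1 n
  (fun i => (U p * U q)`_(n.+1 + i) * 1 ^+ (n.+1 + i))) => i _.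
rewrite expr1n mulr1 coefM.
apply: (@eqmodX_sum0 _ n.+1 _ (fun l => (U p)`_l * (U q)`_(n.+1 + i - l))).
move=> l; rewrite ltnS => li; apply: (@eqmodX_leq _ (n.+1 + i)); first exact: leq_addr.
case: (small p l p0) => s ->; case: (small q (n.+1 + i - l)%N q0) => t ->.
by exists (s * t); rewrite !add0r mulrACA -exprD subnKC.
Qed.

End ExponentialProduct.

(** * The functional equation of the formal Stirling series *)

Section StirlingSeries.
Set Implicit Arguments.
Unset Strict Implicit.
Variables (R : realType).

(* [nuX j] at [1 / n] is [E (U - 1) ^ j / j!] for [U] of Gamma law with shape
   [n + 1] and rate [n]. *)
Fixpoint nuX_pair (j : nat) : {poly R} * {poly R} :=
  if j is i.+1 then let: (u, v) := nuX_pair i in (v, 'X * (v + i.+2%:R^-1 *: u))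
  else (1, 'X).

Definition nuX j := (nuX_pair j).1.

Lemma nuX0 : nuX 0 = 1. Proof. by []. Qed.
Lemma nuX1 : nuX 1 = 'X. Proof. by []. Qed.
Lemma nuXSS j : nuX j.+2 = 'X * (nuX j.+1 + j.+2%:R^-1 *: nuX j).
Proof. by rewrite /nuX /=; case: (nuX_pair j). Qed.

Variable M : nat.
Hypothesis M_gt1 : (1 < M)%N.
Local Notation e := (expX R M).
Local Notation y := (expX R M - 1).
Local Notation bX k := (@LX R M k 1).

(** In [e = 1 + y * 1] the second term integrates by parts to the derivative of [1]; at [k = 0] it
    vanishes since [y] has no constant term. *)
Lemma LX_exp k : ((2 * k) < M)%N -> LX M k e = bX k.
Proof.
move=> kM; have -> : e = 1 + y * 1 by ring.
rewrite LXD; case: k kM => [|k] kM.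
  rewrite [X in _ + X]/LX mulr1 muln0 coef0M.
  by rewrite coefB coef1 coef_expX // fact0 invr1 subrr mul0r mulr0 addr0.
by rewrite -LX_deriv ?derivC ?/LX ?mul0r ?coef0 ?mulr0 ?addr0 //; lia.
Qed.

(** Integrate [y * (e * y ^+ j)] by parts, using [e' = e] modulo ['X^M] and [e = 1 + y]. *)
Lemma LX_exp_mul k j : ((2 * k).+2 < M)%N ->
  LX M k.+1 (e * y ^+ j.+1) = j.+1%:R * LX M k (e * y ^+ j)
     + j%:R * LX M k (e * y ^+ j.-1).
Proof.
move=> kM; rewrite exprS mulrCA -LX_deriv //.
rewrite -!LXZ -LXD; apply: (@LX_eqmodX _ _ _ M); first by lia.
have e' : eqmodX M e^`() e.
  by exists (- M`!%:R^-1%:P); rewrite deriv_expX mulNr mul_polyC.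
rewrite derivM deriv_exp derivB derivC subr0.
have -> : j.+1%:R *: (e * y ^+ j) + j%:R *: (e * y ^+ j.-1)
  = e * y ^+ j + e * (e * y ^+ j.-1 *+ j).
  rewrite mulrnAr !scaler_nat; case: j => [|j]; first by rewrite !mulr0n.
  rewrite /= exprS; ring.
apply: eqmodXD; apply: eqmodXM => //; try exact: eqmodX_refl.
by apply: eqmodXMn; apply: eqmodXM => //; exact: eqmodX_refl.
Qed.

Variable N : nat.
Hypothesis NM : ((2 * N).+2 < M)%N.
Let B : {poly R} := \poly_(k < N.+1) bX k.

(** Formally, [U = exp x] turns the weight [exp x * exp (- n (exp x - 1 - x))] into a multiple of
    the Gamma density, of total mass [B]. The proof compares the recurrences [LX_exp_mul] and
    [nuXSS], carrying two consecutive indices. *)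
Lemma LX_nuX j k : (k <= N)%N ->
  LX M k (e * y ^+ j) = j`!%:R * (nuX j * B)`_k.
Proof.
have y0 F : LX M 0 (y * F) = 0.
  rewrite /LX muln0 -mulrA coef0M.
  by rewrite coefB coef1 coef_expX // fact0 invr1 subrr mul0r mulr0.
suff : (forall k, (k <= N)%N -> LX M k (e * y ^+ j) = j`!%:R * (nuX j * B)`_k)
    /\ (forall k, (k <= N)%N -> LX M k (e * y ^+ j.+1) = j.+1`!%:R * (nuX j.+1 * B)`_k).
  by case=> H _; exact: H.
elim: j {k} => [|j [IH1 IH2]]; split=> //.
- move=> k kN; rewrite expr0 mulr1 fact0 nuX0 !mul1r coef_poly ltnS kN.
  by rewrite LX_exp //; lia.
- move=> [|k] kN; first by rewrite expr1 mulrC y0 nuX1 coefXM mulr0.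
  rewrite LX_exp_mul; last by lia.
  rewrite mul0r addr0 expr0 mulr1 nuX1 coefXM /= !mul1r coef_poly ltnS (ltnW kN).
  by rewrite LX_exp //; lia.
- move=> [|k] kN.
    by rewrite exprS mulrCA y0 nuXSS -mulrA coefXM mulr0.
  rewrite LX_exp_mul; last by lia.
  have -> : (nuX j.+2 * B)`_k.+1 = (nuX j.+1 * B)`_k + j.+2%:R^-1 * (nuX j * B)`_k.
    have -> : nuX j.+2 * B = 'X * (nuX j.+1 * B + j.+2%:R^-1%:P * (nuX j * B)).
      by rewrite nuXSS -mul_polyC; ring.
    by rewrite coefXM coefD coefCM.
  rewrite [j.+1.-1]/= IH1 ?IH2 ?(ltnW kN) // !factS !natrM.
  by field; rewrite -natrD pnatr_eq0.
Qed.

(** The truncated series of [(1 + 'X) ^ (- (i + 1/2))]. *)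
Definition binomX i : {poly R} := \poly_(j < N.+1) gbinom (- (i%:R + 1 / 2)) j.

(* The asymptotic expansions of both sides of
   [sqrt (n / (n + 1)) * r (n + 1) = expR 1 * (1 + 1 / n) ^ (- n - 1) * r n]. *)
Lemma stirling_series_shift :
  eqmodX N.+1 (\sum_(i < N.+1) bX i *: ('X^i * binomX i))
    ((\sum_(j < (2 * N).+1) (-1) ^+ j *: nuX j) * B).
Proof.
apply: coef_eqmodX => k; rewrite ltnS => kN.
have X0 : eqmodX 1 ('X : {poly R}) 0 by exists 1; rewrite expr1; ring.
have y0 : eqmodX 1 (- y) 0.
  apply: coef_eqmodX => -[|//] _; rewrite coefN coefB coef1 coef_expX // coef0.
  by rewrite fact0 invr1 subrr oppr0.
(* Both sides will be [LX M k] of [exp ('X - y)]: the left by expanding in powers of ['X - y], the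
   right by factoring as [exp 'X * exp (- y)]. Order [2 * N] suffices since [LX M k] reads
   coefficients up to degree [2 * k] only. *)
have key := expX_add (2 * N) X0 y0.
have signE j (p : {poly R}) : (- p) ^+ j = (-1) ^+ j *: p ^+ j.
  by rewrite -scaleN1r exprZn.
transitivity (LX M k (\sum_(j < (2 * N).+1) j`!%:R^-1 *: ('X - y) ^+ j)).
  rewrite (LX_sum _ _ _ (fun j => j`!%:R^-1 *: ('X - y) ^+ j)) coef_sum.
  (* By [LX_phi_pow] the power of exponent [j] yields the term [i = k - j], hence the reversal of
     the sum; exponents above [k] contribute nothing. *)
  pose c i : R := bX i * gbinom (- (i%:R + 1 / 2) : R) (k - i).
  transitivity (\sum_(i < k.+1) c i).
    rewrite (big_ord_widen N.+1 c) // [RHS]big_mkcond; apply: eq_bigr => i _.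
    rewrite coefZ coefXnM [(i < k.+1)%N]ltnS [(i <= k)%N]leqNgt.
    case: (ltnP k i) => /= ik; first by rewrite mulr0.
    by rewrite coef_poly ltnS (leq_trans (leq_subr _ _) kN).
  rewrite (reindex_inj rev_ord_inj) /=.
  rewrite (big_ord_widen (2 * N).+1 (fun j => c (k.+1 - j.+1)%N)); last by lia.
  rewrite big_mkcond; apply: eq_bigr => j _; rewrite LXZ -opprB signE LXZ.
  have kM : (2 * k < M)%N by lia.
  rewrite mulrA [_ * (-1) ^+ _]mulrC (LX_phi_pow R M_gt1) // ltnS.
  by case: ifP => // jk; rewrite /c subSS subKn // mulrC.
rewrite (@LX_eqmodX R M k (2 * N).+1 _ _ _ key); last by lia.
transitivity (LX M k (\sum_(j < (2 * N).+1) ((-1) ^+ j / j`!%:R) *: (e * y ^+ j))).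
  apply: (@LX_eqmodX _ _ _ (2 * N).+1); first by lia.
  rewrite (_ : \sum_(j < (2 * N).+1) _ *: (e * _) =
      e * \sum_(j < (2 * N).+1) j`!%:R^-1 *: (- y) ^+ j).
    apply: eqmodXM; last exact: eqmodX_refl.
    apply: coef_eqmodX => i i_n; rewrite -(poly_def _ (fun j => j`!%:R^-1)).
    rewrite coef_poly i_n coef_expX //.
    by lia.
  rewrite mulr_sumr; apply: eq_bigr => j _; rewrite signE scalerA -scalerAr.
  by rewrite [_^-1 * _]mulrC.
rewrite (LX_sum _ _ _ (fun j => ((-1) ^+ j / j`!%:R) *: (e * y ^+ j))) mulr_suml coef_sum.
apply: eq_bigr => j _; rewrite LXZ LX_nuX // -mul_polyC -[_%:P * _ * _]mulrA coefCM.
by field; rewrite factR_neq0.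
Qed.

End StirlingSeries.

(** * The closed formula for the coefficients *)

Section CoefficientFormula.
Set Implicit Arguments.
Unset Strict Implicit.
Variable R : realType.

Definition stirling_formula (k : nat) : R :=
  (2 * k)`!%:R / (2 ^+ k * k`!%:R) *
    \sum_(i < (2 * k).+1)
      gbinom (k%:R + i%:R - 1 / 2) i * gbinom (3 * k%:R + 1 / 2) (2 * k - i) *
      2 ^+ i *
      \sum_(j < i.+1)
        'C(i, j)%:R * (-1) ^+ j * j`!%:R *
        ((stirling2 (2 * k + i + j) j)%:R / (2 * k + i + j)`!%:R).

(** Multiplying by ['X^(2i)] turns [(- gX)^i] into [2^i * ('X - (exp x - 1))^i]. In its binomial
    expansion the factor ['X^(i - j)] leaves the coefficient of degree [2k + i + j] of
    [(exp x - 1)^j], a Stirling number up to factorials. *)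
Lemma coef_gX_pow M i k : (1 < M)%N -> (2 * k + 2 * i <= M)%N ->
  ((- gX R M) ^+ i)`_(2 * k) =
  2 ^+ i * \sum_(j < i.+1) 'C(i, j)%:R * (-1) ^+ j * j`!%:R *
        ((stirling2 (2 * k + i + j) j)%:R / (2 * k + i + j)`!%:R).
Proof.
move=> M1 kiM.
have -> : ((- gX R M) ^+ i)`_(2 * k) = ('X^(2 * i) * (- gX R M) ^+ i)`_(2 * k + 2 * i).
  by rewrite coefXnM ltnNge leq_addl /= addnK.
have -> : 'X^(2 * i) * (- gX R M) ^+ i = 2 ^+ i *: ('X - (expX R M - 1)) ^+ i.
  by rewrite exprM -exprMn mulrN mulX2_gX // -scalerN opprB exprZn.
rewrite coefZ; congr (_ * _); rewrite exprDn coef_sum; apply: eq_bigr => j _.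
have ji : (j <= i)%N by rewrite -ltnS.
rewrite coefMn coefXnM.
have -> : (2 * k + 2 * i < i - j)%N = false by lia.
have -> : (2 * k + 2 * i - (i - j) = 2 * k + i + j)%N by lia.
rewrite -scaleN1r exprZn coefZ coef_expX_sub1_pow; last by lia.
by rewrite -mulr_natl; ring.
Qed.

Lemma LX1_formula M k : (1 < M)%N -> (6 * k <= M)%N ->
  LX M k (1 : {poly R}) = stirling_formula k.
Proof.
move=> M1 kM; rewrite /LX mul1r /stirling_formula /oddfact; congr (_ * _).
pose c m := gbinom (- (k%:R + 1 / 2) : R) m *: (gX R M - 1) ^+ m.
(* Powers of [gX - 1] above [2k] do not reach degree [2k]. Cutting there makes
   [binomial_series_trunc] apply with [x + n = 3k + 1/2]; the largest degree then needed is
   [2k + 2 (2k) = 6k]. *)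
transitivity ((\sum_(m < (2 * k).+1) c m)`_(2 * k)).
  rewrite /WX !coef_sum.
  rewrite (@big_ord_widen _ _ _ (2 * k).+1 M.+1 (fun m => (c m)`_(2 * k))); last by lia.
  rewrite [RHS]big_mkcond; apply: eq_bigr => m _; case: ifP => // km.
  have mk : (2 * k < m)%N by lia.
  rewrite coefZ (eqmodX_coef (eqmodX_gX_sub1_pow R M1 (leqnn m)) mk).
  by rewrite coef0 mulr0.
rewrite binomial_series_trunc coef_sum; apply: eq_bigr => i _.
rewrite coefZ coef_gX_pow //; last by have := ltn_ord i; lia.
rewrite mulrA; congr (_ * _ * _ * _).
  by congr gbinom; field.
by congr gbinom; rewrite natrM; field.
Qed.

Lemma stirling_formula0 : stirling_formula 0 = 1.
Proof.
rewrite -(@LX1_formula 2 0) // /LX /oddfact muln0 mul1r fact0 expr0 mul1r divr1.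
rewrite /WX coef_sum big_ord_recl gbinom0 scale1r expr0 coef1 big1 ?addr0 ?mulr1 // => m _.
by rewrite coefZ (eqmodX_coef (eqmodX_gX_sub1_pow R _ (leqnn m.+1))) // coef0 mulr0.
Qed.

End CoefficientFormula.

(** * Asymptotics in powers of 1/n *)

Section InversePowers.
Set Implicit Arguments.
Unset Strict Implicit.
Variable R : realType.
Implicit Types u v : nat -> R.

Local Notation z n := ((n%:R : R)^-1).

(** The class [O(n ^ (- m))]; a nonnegative constant allows [z n ^+ m] to be replaced by a larger
    quantity. *)
Definition Oinv (m : nat) u := exists2 C : R, 0 <= C &
  exists n0, forall n, (n0 <= n)%N -> `|u n| <= C * z n ^+ m.

Lemma Oinv_ext n0 m u v :
  (forall n, (n0 <= n)%N -> u n = v n) -> Oinv m u -> Oinv m v.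
Proof.
move=> uv [C C0 [n1 H]]; exists C => //; exists (maxn n0 n1) => n.
by rewrite geq_max => /andP[h0 h1]; rewrite -uv // H.
Qed.

Lemma OinvD m u v : Oinv m u -> Oinv m v -> Oinv m (fun n => u n + v n).
Proof.
move=> [C C0 [n0 Hu]] [D D0 [n1 Hv]]; exists (C + D); first exact: addr_ge0.
exists (maxn n0 n1) => n; rewrite geq_max => /andP[h0 h1].
by rewrite mulrDl (le_trans (ler_normD _ _)) // lerD // ?Hu ?Hv.
Qed.

Lemma OinvM m k u v : Oinv m u -> Oinv k v -> Oinv (m + k) (fun n => u n * v n).
Proof.
move=> [C C0 [n0 Hu]] [D D0 [n1 Hv]]; exists (C * D); first exact: mulr_ge0.
exists (maxn n0 n1) => n; rewrite geq_max => /andP[h0 h1].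
by rewrite exprD mulrACA normrM ler_pM // ?Hu ?Hv.
Qed.

Lemma OinvN m u : Oinv m u -> Oinv m (fun n => - u n).
Proof.
by move=> [C C0 [n0 Hu]]; exists C => //; exists n0 => n; rewrite normrN; exact: Hu.
Qed.

Lemma OinvB m u v : Oinv m u -> Oinv m v -> Oinv m (fun n => u n - v n).
Proof. by move=> Ou Ov; apply: OinvD => //; exact: OinvN. Qed.

Lemma Oinv_le m k u : (k <= m)%N -> Oinv m u -> Oinv k u.
Proof.
move=> km [C C0 [n0 Hu]]; exists C => //; exists (maxn 1 n0) => n.
rewrite geq_max => /andP[n1 nn0]; apply: le_trans (Hu _ nn0) _.
rewrite ler_wpM2l // ler_wiXn2l // ?invr_ge0 ?ler0n // invf_le1 ?ler1n // ltr0n //.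
Qed.

Lemma Oinv_cst c : Oinv 0 (fun=> c).
Proof. by exists `|c| => //; exists 0%N => n _; rewrite expr0 mulr1. Qed.

Lemma Oinv_z : Oinv 1 (fun n => z n).
Proof.
exists 1 => //; exists 0%N => n _.
by rewrite expr1 mul1r ger0_norm // invr_ge0 ler0n.
Qed.

Lemma Oinv_zX m : Oinv m (fun n => z n ^+ m).
Proof.
exists 1 => //; exists 0%N => n _.
by rewrite mul1r ger0_norm // exprn_ge0 // invr_ge0 ler0n.
Qed.

Lemma OinvMl c m u : Oinv m u -> Oinv m (fun n => c * u n).
Proof. by move=> Ou; have := OinvM (Oinv_cst c) Ou. Qed.

Lemma OinvMr m u v : Oinv m u -> Oinv 0 v -> Oinv m (fun n => u n * v n).
Proof. by move=> Ou Ov; have := OinvM Ou Ov; rewrite addn0. Qed.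

Lemma Oinv_sum m k (F : nat -> nat -> R) : (forall i, (i < k)%N -> Oinv m (F i)) ->
  Oinv m (fun n => \sum_(i < k) F i n).
Proof.
elim: k => [|k IH] FO.
  apply: (@Oinv_ext 0 _ (fun n => 0 * z n ^+ m)).
    by move=> n _; rewrite mul0r big_ord0.
  exact/OinvMl/Oinv_zX.
apply: (@Oinv_ext 0 _ (fun n => \sum_(i < k) F i n + F k n)).
  by move=> n _; rewrite big_ord_recr.
by apply: OinvD; [apply: IH => i ik; apply: FO; exact: ltnW|exact: FO].
Qed.

Lemma Oinv_poly (p : {poly R}) : Oinv 0 (fun n => p.[z n]).
Proof.
apply: (@Oinv_ext 0 _ (fun n => \sum_(i < size p) p`_i * z n ^+ i)).
  by move=> n _; rewrite horner_coef.
apply: (Oinv_sum (F := fun i n => p`_i * z n ^+ i)) => i _.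
exact/OinvMl/(Oinv_le (leq0n i))/Oinv_zX.
Qed.

(** The bridge from formal congruences to asymptotic estimates. *)
Lemma Oinv_eqmodX m (p q : {poly R}) : eqmodX m p q ->
  Oinv m (fun n => p.[z n] - q.[z n]).
Proof.
move=> [r ->]; apply: (@Oinv_ext 0 _ (fun n => z n ^+ m * r.[z n])).
  by move=> n _; rewrite !hornerE; ring.
exact: OinvMr (Oinv_zX m) (Oinv_poly r).
Qed.

Lemma Oinv1_cst0 c : Oinv 1 (fun=> c) -> c = 0.
Proof.
move=> [C C0 [n0 H]]; apply/eqP/negP => /negP c0.
have c1 : 0 < `|c| by rewrite normr_gt0.
pose n := maxn 1 (maxn n0 (Num.truncn (C / `|c|)).+1).
have nn0 : (n0 <= n)%N by lia.
have nt : ((Num.truncn (C / `|c|)).+1 <= n)%N by lia.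
have := H n nn0; rewrite expr1 ler_pdivlMr ?ltr0n; last by lia.
apply/negP; rewrite -ltNge -ltr_pdivrMl // mulrC.
apply: lt_le_trans (truncnS_gt _) _; by rewrite ler_nat.
Qed.

Lemma Oinv_shift m u : Oinv m u -> Oinv m (fun n => u n.+1).
Proof.
move=> [C C0 [n0 H]]; exists C => //; exists (maxn 1 n0) => n.
rewrite geq_max => /andP[n1 nn0]; apply: le_trans (H _ (leq_trans nn0 _)) _ => //.
by rewrite ler_wpM2l // lerXn2r ?nnegrE ?invr_ge0 // lef_pV2 ?posrE ?ltr0n // ler_nat.
Qed.

Lemma Oinv_near1_gt0 u : Oinv 1 (fun n => u n - 1) ->
  exists n0, forall n, (n0 <= n)%N -> 0 < u n.
Proof.
move=> [C C0 [n0 H]]; exists (maxn (Num.truncn C).+1 n0) => n.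
rewrite geq_max => /andP[Cn nn0].
have n_gt0 : 0 < n%:R :> R by rewrite ltr0n; lia.
have Cn1 : C * z n < 1.
  rewrite ltr_pdivrMr // mul1r; apply: lt_le_trans (truncnS_gt _) _.
  by rewrite ler_nat.
have := H n nn0; rewrite expr1 => /le_lt_trans/(_ Cn1).
by rewrite ltr_norml; lra.
Qed.

End InversePowers.

(** * Analytic estimates for the factors of the functional equation *)

Section ShiftFactors.
Set Implicit Arguments.
Unset Strict Implicit.
Variable R : realType.

Local Notation z n := ((n%:R : R)^-1).

Lemma eqmodX_deriv0 m (p : {poly R}) : eqmodX m p^`() 0 -> eqmodX m.+1 p (p`_0)%:P.
Proof.
move=> p0; apply: coef_eqmodX => -[|i] im; rewrite coefC //=.
have := eqmodX_coef p0 (im : (i < m)%N); rewrite coef_deriv coef0 => /eqP.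
by rewrite mulrn_eq0 /= => /eqP.
Qed.

(** Squaring removes the half-integer exponent. The derivative vanishes modulo ['X^N] because
    [(1 + 'X) P' = - (i + 1/2) P] there, and the constant term is [1]. *)
Lemma binomX_sqr N i : eqmodX N.+1 (binomX R N i ^+ 2 * (1 + 'X) ^+ (2 * i).+1) 1.
Proof.
set P := binomX R N i.
have P0 : P`_0 = 1 by rewrite coef_poly gbinom0.
have F0 : (P ^+ 2 * (1 + 'X) ^+ (2 * i).+1)`_0 = 1.
  by rewrite -horner_coef0 !hornerE horner_coef0 P0 !expr1n mulr1.
suff D : eqmodX N (P ^+ 2 * (1 + 'X) ^+ (2 * i).+1)^`() 0.
  by have := eqmodX_deriv0 D; rewrite F0.
have resid : eqmodX N ((1 + 'X) * P^`() + (i%:R + 1 / 2) *: P) 0.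
  apply: coef_eqmodX => j jN; rewrite mulrDl mul1r !coefD coefXM coefZ !coef_deriv.
  rewrite coef0 !coef_poly !ltnS jN (ltnW jN).
  rewrite -[_ *+ j.+1]mulr_natl gbinom_recr.
  case: j jN => [|j] jN; rewrite /= ?coef_deriv; first by ring.
  by rewrite (ltnW jN) -[_ *+ j.+1]mulr_natl; ring.
have -> : (P ^+ 2 * (1 + 'X) ^+ (2 * i).+1)^`()
    = (2 *: (P * (1 + 'X) ^+ (2 * i))) * ((1 + 'X) * P^`() + (i%:R + 1 / 2) *: P).
  rewrite derivM !deriv_exp derivD derivC derivX add0r /= expr1.
  rewrite -!mul_polyC exprS.
  have -> : (i%:R + 1 / 2 : R)%:P = 2^-1%:P * ((2 * i).+1%:R)%:P.
    rewrite -polyCM; congr (_%:P); rewrite -[(2 * i).+1%:R]natr1 natrM; field.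
    by [].
  have h : (2 : R)%:P * 2^-1%:P = 1 by rewrite -polyCM mulfV.
  transitivity (2%:P * (P * (1 + 'X) ^+ (2 * i)) * (1 + 'X) * P^`()
     + (2%:P * 2^-1%:P) * (P * (1 + 'X) ^+ (2 * i)) * ((2 * i).+1%:R)%:P * P); last by ring.
  rewrite h !polyC_natr; ring.
rewrite -[X in eqmodX _ _ X](mulr0 (2 *: (P * (1 + 'X) ^+ (2 * i)))).
by apply: eqmodXM => //; exact: eqmodX_refl.
Qed.

(** The square root of [binomX_sqr]: for [u >= 0], [|u - 1| <= |u^2 - 1|]. Nonnegativity of [u]
    holds for large [n], where [P.[z n]] is positive. *)
Lemma binomX_approx N i :
  Oinv N.+1 (fun n => (binomX R N i).[z n] * (1 + z n) ^+ i * Num.sqrt (1 + z n) - 1).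
Proof.
set P := binomX R N i.
have [n0 Ppos] : exists n0, forall n, (n0 <= n)%N -> 0 < P.[z n].
  apply: Oinv_near1_gt0.
  have P1 : eqmodX 1 P 1.
    by apply: coef_eqmodX => -[|//] _; rewrite coef_poly gbinom0 coef1.
  by apply: (@Oinv_ext _ 0 _ _ _ _ (Oinv_eqmodX P1)) => n _; rewrite hornerC.
have [C C0 [n1 H]] := Oinv_eqmodX (binomX_sqr N i).
exists C => //; exists (maxn n0 n1) => n; rewrite geq_max => /andP[nn0 nn1].
apply: le_trans (H n nn1); set u := _ * Num.sqrt _.
have w0 : 0 <= 1 + z n by rewrite addr_ge0 // invr_ge0.
have u0 : 0 <= u.
  by rewrite !mulr_ge0 ?exprn_ge0 ?sqrtr_ge0 // ltW // Ppos.
have -> : (P ^+ 2 * (1 + 'X) ^+ (2 * i).+1).[z n] = u ^+ 2.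
  rewrite /u !hornerE exprMn sqr_sqrtr //.
  have -> : (1 + z n) ^+ (2 * i).+1 = (1 + z n) ^+ i ^+ 2 * (1 + z n).
    by rewrite -exprM mulnC exprSr.
  ring.
rewrite hornerC.
have -> : u ^+ 2 - 1 = (u - 1) * (u + 1) by ring.
have u1 : 0 <= u + 1 by rewrite addr_ge0.
by rewrite normrM ler_peMr // (ger0_norm u1) lerDr.
Qed.

Lemma MVT_everywhere (f df : R -> R) (a b : R) : a <= b ->
  (forall x : R, is_derive x 1 f (df x)) ->
  exists2 c, a <= c <= b & f b - f a = df c * (b - a).
Proof.
move=> ab dfE; have [|c] := @MVT_segment R f df a b ab (fun x _ => dfE x).
  apply/continuous_subspaceT=> r.
  exact/differentiable_continuous/derivable1_diffP.
by rewrite in_itv /= => cab E; exists c.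
Qed.

Lemma nuX_ge0 j x : 0 <= x -> 0 <= (nuX R j).[x].
Proof.
move=> x0; suff : 0 <= (nuX R j).[x] /\ 0 <= (nuX R j.+1).[x] by case.
elim: j => [|j [IH1 IH2]]; first by rewrite nuX0 nuX1 !hornerE.
by split=> //; rewrite nuXSS !hornerE mulr_ge0 // addr_ge0 // mulr_ge0.
Qed.

(** Every two steps of the recurrence [nuXSS] gain one factor ['X]. *)
Lemma eqmodX_nuX j : eqmodX (uphalf j) (nuX R j) 0.
Proof.
suff : eqmodX (uphalf j) (nuX R j) 0 /\ eqmodX (uphalf j.+1) (nuX R j.+1) 0 by case.
elim: j => [|j [IH1 IH2]].
  split; first by exists 1; rewrite nuX0 /=; ring.
  by exists 1; rewrite nuX1 /= expr1; ring.
split=> //; rewrite nuXSS /=.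
have [r ->] : eqmodX (uphalf j) (nuX R j.+1 + j.+2%:R^-1 *: nuX R j) 0.
  rewrite -[X in eqmodX _ _ X](addr0 0); apply: eqmodXD.
    by apply: eqmodX_leq IH2; rewrite /= uphalf_half; lia.
  by rewrite -[X in eqmodX _ _ X](scaler0 _ j.+2%:R^-1); exact: eqmodXZ.
by exists r; rewrite !add0r exprS; ring.
Qed.

(* [Q t = T t * expR (- t) * (1 + t / n) ^ n.+1] has a tiny derivative since the
   partial sum [T] almost satisfies the differential equation of
   [expR t * (1 + t / n) ^ (- n.+1)]. *)
Lemma nuX_sum_error n J : (0 < n)%N ->
  `|(\sum_(j < J.+1) (-1) ^+ j *: nuX R j).[z n]
      * (expR (-1) * (1 + z n) ^+ n.+1) - 1|
    <= J.+1%:R * (nuX R J.+1).[z n] + z n * (nuX R J).[z n].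
Proof.
move=> n0.
have nz : n%:R * z n = 1 by rewrite mulfV // pnatr_eq0 -lt0n.
have z0 : 0 <= z n by rewrite invr_ge0.
pose nu j := (nuX R j).[z n].
(* A truncation of [E (expR (- t (U - 1))) = expR t * (1 + t / n) ^ (- n.+1)]; the sum in the
   statement is its value at [t = 1]. *)
pose T k : {poly R} := \sum_(j < k.+1) ((-1) ^+ j * nu j) *: 'X^j.
have nuE j : j.+2%:R * nu j.+2 = z n * (j.+2%:R * nu j.+1 + nu j).
  rewrite /nu nuXSS hornerM hornerX hornerD hornerZ; field.
  by rewrite -natrD !pnatr_eq0 -lt0n n0.
(* The full series makes the left-hand side zero; truncation leaves only terms of degree [k] and
   [k + 1]. *)
have TE k t : (1 + z n * t) * (T k)^`().[t] + z n * ((1 - t) * (T k).[t]) =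
   - ((-1) ^+ k.+1 * (k.+1%:R * nu k.+1) * t ^+ k + z n * (-1) ^+ k * nu k * t ^+ k.+1).
  elim: k => [|k IH].
    rewrite /T big_ord1 derivZ derivXn /nu nuX0 nuX1 mulr0n scaler0 !hornerE /=; ring.
  rewrite /T big_ord_recr /= -/(T k) derivD derivZ derivXn /= nuE.
  rewrite !hornerD !hornerZ hornerMn !hornerXn.
  transitivity (((1 + z n * t) * (T k)^`().[t] + z n * ((1 - t) * (T k).[t])) +
    ((-1) ^+ k.+1 * nu k.+1) *
    ((1 + z n * t) * (k.+1%:R * t ^+ k) + z n * (1 - t) * t ^+ k.+1)).
    rewrite -mulr_natr; ring.
  rewrite IH !exprS -[k.+2%:R]natr1; ring.
pose W : {poly R} := (1 + z n *: 'X) ^+ n.+1.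
pose f (t : R) := (T J * W).[t] * expR (- t).
pose df (t : R) := expR (- t) * (1 + z n * t) ^+ n *
   ((1 + z n * t) * (T J)^`().[t] + z n * ((1 - t) * (T J).[t])).
have dfE (t : R) : is_derive t 1 f (df t).
  have dE : is_derive t 1 (expR \o -%R : R -> R) (expR (- t) * (- 1)).
    exact: is_derive1_comp.
  have fE : f = horner (T J * W) * (expR \o -%R : R -> R) by exact/funext.
  rewrite fE; apply: (is_derive_eq (is_deriveM (is_derive_poly (T J * W) t) dE)).
  have w : (1 + z n *: 'X).[t] = 1 + z n * t by rewrite !hornerE.
  have W' : W^`() = (z n)%:P * (1 + z n *: 'X) ^+ n *+ n.+1.
    by rewrite /W deriv_exp derivD derivC derivZ derivX add0r alg_polyC.
  rewrite /df derivM hornerD !hornerM W' /W hornerMn hornerM !horner_exp w hornerC.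
  rewrite /= /GRing.scale /= mulrSr exprS.
  transitivity (expR (- t) * (1 + z n * t) ^+ n *
    ((1 + z n * t) * (T J)^`().[t] + (n%:R * z n + z n - 1 - z n * t) * (T J).[t])); first by ring.
  by rewrite nz; ring.
have [c /andP[c0 c1]] := MVT_everywhere ler01 dfE.
have -> : f 0 = 1.
  rewrite /f oppr0 expR0 mulr1 hornerM /W horner_exp !hornerE expr1n.
  rewrite /T horner_sum big_ord_recl big1 => [|j _]; first by rewrite /nu nuX0 !hornerE.
  by rewrite hornerZ hornerXn expr0n mulr0.
have -> : f 1 = (\sum_(j < J.+1) (-1) ^+ j *: nuX R j).[z n] * (expR (-1) * (1 + z n) ^+ n.+1).
  have W1 : W.[1] = (1 + z n) ^+ n.+1 by rewrite /W horner_exp !hornerE.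
  have T1 : (T J).[1] = (\sum_(j < J.+1) (-1) ^+ j *: nuX R j).[z n].
    rewrite /T !horner_sum; apply: eq_bigr => j _.
    by rewrite !hornerZ hornerXn expr1n mulr1.
  by rewrite /f hornerM W1 T1; ring.
rewrite subr0 mulr1 => ->; rewrite /df TE normrM.
(* This is [1 + x <= expR x] at [x = c / n], raised to the power [n]. *)
have e1 : `|expR (- c) * (1 + z n * c) ^+ n| <= 1.
  have w0 : 0 <= 1 + z n * c by rewrite addr_ge0 // mulr_ge0.
  rewrite ger0_norm ?mulr_ge0 ?expR_ge0 ?exprn_ge0 // expRN ler_pdivrMl ?expR_gt0 // mulr1.
  have -> : expR c = expR (z n * c) ^+ n by rewrite -expRM_natl mulrA nz mul1r.
  by rewrite lerXn2r ?nnegrE ?expR_ge0 // expR_ge1Dx.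
rewrite -[leRHS]mul1r ler_pM // normrN.
have cX k : `|c ^+ k| <= 1 by rewrite ger0_norm ?exprn_ge0 // exprn_ile1.
have nu0 k : 0 <= nu k by exact: nuX_ge0.
apply: le_trans (ler_normD _ _) _; rewrite lerD //.
  by rewrite !normrM normr_sign mul1r (ger0_norm (nu0 _)) normr_nat ler_piMr // mulr_ge0.
by rewrite !normrM normr_sign mulr1 (ger0_norm (nu0 _)) (ger0_norm z0) ler_piMr // mulr_ge0.
Qed.

End ShiftFactors.

(** * The functional equation of the Stirling ratio and its lower bound *)

Section StirlingRatio.
Set Implicit Arguments.
Unset Strict Implicit.
Variable R : realType.

Local Notation z n := ((n%:R : R)^-1).

Lemma inv_succ n : (0 < n)%N -> z n.+1 = z n / (1 + z n).
Proof.
move=> n0; have n0R : n%:R != 0 :> R by rewrite pnatr_eq0 -lt0n.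
have n1R : n%:R + 1 != 0 :> R by rewrite natr1 pnatr_eq0.
by rewrite -natr1; field; rewrite n0R n1R.
Qed.

Lemma inv_succB n : (0 < n)%N -> z n.+1 = z n - z n * z n.+1.
Proof.
move=> n0; have n0R : n%:R != 0 :> R by rewrite pnatr_eq0 -lt0n.
have n1R : n%:R + 1 != 0 :> R by rewrite natr1 pnatr_eq0.
by rewrite -natr1; field; rewrite n0R n1R.
Qed.

Lemma Oinv_bound n0 m (u v : nat -> R) :
  (forall n, (n0 <= n)%N -> `|u n| <= v n) -> Oinv m v -> Oinv m u.
Proof.
move=> uv [C C0 [n1 H]]; exists C => //; exists (maxn n0 n1) => n.
rewrite geq_max => /andP[h0 h1]; apply: le_trans (uv _ h0) _.
exact: le_trans (ler_norm _) (H _ h1).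
Qed.

Definition rho (n : nat) : R :=
  Num.sqrt (1 + z n) / (expR (-1) * (1 + z n) ^+ n.+1).

Lemma stirling_ratioS n : (0 < n)%N ->
  stirling_ratio R n.+1 = rho n * stirling_ratio R n.
Proof.
move=> n0; have n0R : 0 < n%:R :> R by rewrite ltr0n.
have wE : 1 + z n = n.+1%:R / n%:R.
  by rewrite -natr1; field; rewrite gt_eqF.
have w0 : 0 < 1 + z n by rewrite wE divr_gt0 ?ltr0n.
have pin : 0 < 2 * pi * n%:R :> R by rewrite !mulr_gt0 ?pi_gt0.
have -> : stirling_ratio R n.+1 = n.+1%:R * n`!%:R / (n.+1%:R ^+ n.+1 *
   (expR (- n%:R) * expR (-1)) * (Num.sqrt (2 * pi * n%:R) * Num.sqrt (1 + z n))).
  rewrite /stirling_ratio factS natrM -expRD -sqrtrM ?(ltW pin) //.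
  rewrite -opprD natr1; congr (_ / (_ * Num.sqrt _)).
  by rewrite wE; field; rewrite gt_eqF.
have q0 : 0 < Num.sqrt (1 + z n) by rewrite sqrtr_gt0.
have s0 : 0 < Num.sqrt (2 * pi * n%:R) :> R by rewrite sqrtr_gt0.
have e0 x : expR x != 0 :> R by rewrite gt_eqF ?expR_gt0.
have q2 : Num.sqrt (1 + z n) ^+ 2 * n%:R = n.+1%:R.
  by rewrite sqr_sqrtr ?(ltW w0) // wE divfK // gt_eqF.
rewrite -[X in X * _ / _]q2 /rho /stirling_ratio.
have -> : (1 + z n) ^+ n.+1 = n.+1%:R ^+ n.+1 / (n%:R * n%:R ^+ n).
  by rewrite wE expr_div_n [n%:R ^+ _.+1]exprS.
have nn : n.+1%:R ^+ n.+1 != 0 :> R by rewrite expf_neq0 // pnatr_eq0.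
have nn' : n%:R ^+ n != 0 :> R by rewrite expf_neq0 // gt_eqF.
move: (n.+1%:R ^+ n.+1) nn (n%:R ^+ n) nn' => A A0 B B0.
by field; rewrite A0 B0 !e0 !gt_eqF.
Qed.

Lemma rho_bounds n : (0 < n)%N ->
  [/\ 0 < 1 + z n, 1 <= 1 + z n, Num.sqrt (1 + z n) <= 2 & 0 <= rho n <= 2 * expR 1].
Proof.
move=> n0; have z0 : 0 < z n by rewrite invr_gt0 ltr0n.
have z1 : z n <= 1 by rewrite invf_le1 ?ler1n // ltr0n.
have w0 : 0 < 1 + z n by rewrite addr_gt0.
have w1 : 1 <= 1 + z n by rewrite lerDl ltW.
have q2 : Num.sqrt (1 + z n) <= 2.
  by rewrite -[leRHS]ger0_norm // -sqrtr_sqr ler_wsqrtr // expr2; lra.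
split => //; rewrite /rho expRN invfM invrK.
rewrite !mulr_ge0 ?sqrtr_ge0 ?expR_ge0 ?invr_ge0 ?exprn_ge0 ?(ltW w0) //=.
rewrite ler_pM ?sqrtr_ge0 ?mulr_ge0 ?expR_ge0 ?invr_ge0 ?exprn_ge0 ?(ltW w0) //.
by rewrite ler_piMr ?expR_ge0 // invf_le1 ?exprn_gt0 // exprn_ege1.
Qed.

Lemma Oinv_rho : Oinv 0 rho.
Proof.
apply: (@Oinv_bound 1 _ _ (fun=> 2 * expR 1)); last exact: Oinv_cst.
by move=> n n0; have [_ _ _ /andP[r0 r2]] := rho_bounds n0; rewrite ger0_norm.
Qed.

(** At [J = 2N] both error terms of [nuX_sum_error] have order [N + 1] by [eqmodX_nuX], the second
    thanks to its extra factor [z n]. *)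
Lemma nuX_sum_approx N : Oinv N.+1 (fun n =>
  (\sum_(j < (2 * N).+1) (-1) ^+ j *: nuX R j).[z n]
    * (expR (-1) * (1 + z n) ^+ n.+1) - 1).
Proof.
apply: (Oinv_bound (n0 := 1)) => [n n0|]; first exact: nuX_sum_error.
have nuO j : Oinv (uphalf j) (fun n => (nuX R j).[z n]).
  by apply: (Oinv_ext (n0 := 0)) (Oinv_eqmodX (eqmodX_nuX R j)) => n _; rewrite hornerC subr0.
apply: OinvD.
  by apply: OinvMl; apply: Oinv_le (nuO _); rewrite /= mul2n doubleK.
have := OinvM (Oinv_z R) (nuO (2 * N)%N); apply: Oinv_le.
by rewrite mul2n uphalf_double.
Qed.

Definition stirling_poly (N : nat) : {poly R} :=
  \poly_(k < N.+1) stirling_formula R k.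

(** Evaluate [stirling_series_shift] at [1 / n] and multiply by [sqrt (1 + 1/n)]; as
    [1 / (n + 1) = z / (1 + z)] for [z = 1 / n], the left side becomes the series at
    [1 / (n + 1)]. *)
Lemma stirling_poly_shift N : Oinv N.+1 (fun n =>
  (stirling_poly N).[z n.+1] - rho n * (stirling_poly N).[z n]).
Proof.
(* Large enough both for [LX1_formula] at every [k <= N] and for [stirling_series_shift]. *)
pose M := (6 * N + 4)%N; pose B := stirling_poly N.
have M1 : (1 < M)%N by rewrite /M; lia.
have NM : ((2 * N).+2 < M)%N by rewrite /M; lia.
have LXE k : (k <= N)%N -> LX M k (1 : {poly R}) = stirling_formula R k.
  by move=> kN; apply: LX1_formula => //; rewrite /M; lia.
pose b i := stirling_formula R i.
pose P i := binomX R N i.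
pose S : {poly R} := \sum_(j < (2 * N).+1) (-1) ^+ j *: nuX R j.
have e1 : eqmodX N.+1 (\sum_(i < N.+1) b i *: ('X^i * P i)) (S * B).
  have := stirling_series_shift R M1 NM.
  have -> : \poly_(k < N.+1) LX M k (1 : {poly R}) = B.
    by apply/polyP => i; rewrite !coef_poly ltnS; case: ifP => // /LXE.
  congr eqmodX; apply: eq_bigr => i _; rewrite LXE //.
  by rewrite -ltnS.
have q0 : Oinv 0 (fun n => Num.sqrt (1 + z n)).
  apply: (@Oinv_bound 1 _ _ (fun=> 2)); last exact: Oinv_cst.
  by move=> n n0; have [_ _ ? _] := rho_bounds n0; rewrite ger0_norm ?sqrtr_ge0.
have w0 i : Oinv 0 (fun n => (1 + z n) ^- i).
  apply: (@Oinv_bound 1 _ _ (fun=> 1)); last exact: Oinv_cst.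
  move=> n n0; have [w0 w1 _ _] := rho_bounds n0.
  by rewrite ger0_norm ?invr_ge0 ?exprn_ge0 ?(ltW w0) // invf_le1 ?exprn_gt0 // exprn_ege1.
(* Three errors add up: the congruence [e1], the replacement of [(1 + z n) ^ (- (i + 1/2))] by
   [P i], and that of the exponential factor by [S]. *)
apply: (@Oinv_ext _ 1 _ (fun n =>
  (Num.sqrt (1 + z n) * ((\sum_(i < N.+1) b i *: ('X^i * P i)).[z n] - (S * B).[z n])
   - \sum_(i < N.+1) b i * (z n ^+ i * (1 + z n) ^- i *
        ((P i).[z n] * (1 + z n) ^+ i * Num.sqrt (1 + z n) - 1)))
   + rho n * B.[z n] * (S.[z n] * (expR (-1) * (1 + z n) ^+ n.+1) - 1))).
  move=> n n0; have [w_gt0 _ _ _] := rho_bounds n0.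
  have wn := lt0r_neq0 w_gt0.
  have -> : B.[z n.+1] = \sum_(i < N.+1) b i * (z n ^+ i * (1 + z n) ^- i).
    rewrite horner_poly; apply: eq_bigr => i _; rewrite -exprVn -exprMn; congr (_ * _ ^+ _).
    exact: inv_succ.
  rewrite horner_sum mulrBr mulr_sumr hornerM.
  have -> : \sum_(i < N.+1) b i * (z n ^+ i * (1 + z n) ^- i) =
    \sum_(i < N.+1) Num.sqrt (1 + z n) * (b i *: ('X^i * P i)).[z n]
    - \sum_(i < N.+1) b i * (z n ^+ i * (1 + z n) ^- i *
        ((P i).[z n] * (1 + z n) ^+ i * Num.sqrt (1 + z n) - 1)).
    rewrite -sumrB; apply: eq_bigr => i _; rewrite hornerZ hornerM hornerXn.
    by field; rewrite expf_neq0.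
  have rE : rho n * (expR (-1) * (1 + z n) ^+ n.+1) = Num.sqrt (1 + z n).
    by rewrite /rho divfK // mulf_neq0 ?expf_neq0 // gt_eqF // expR_gt0.
  rewrite -[in X in _ - X * (_ * B.[_])]rE; ring.
have e1O := Oinv_eqmodX e1.
apply: OinvD; first apply: OinvB.
- by have := OinvM q0 e1O.
- apply: (Oinv_sum (F := fun i n => b i * (z n ^+ i * (1 + z n) ^- i *
        ((P i).[z n] * (1 + z n) ^+ i * Num.sqrt (1 + z n) - 1)))) => i _.
  apply: OinvMl; have := OinvM (OinvMr (Oinv_zX R i) (w0 i)) (binomX_approx R N i).
  by apply: Oinv_le; rewrite leq_addl.
- have := OinvM (OinvMr Oinv_rho (Oinv_poly B)) (nuX_sum_approx N).
  by rewrite add0n.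
Qed.

Lemma z_shift k : Oinv k.+2 (fun n => z n.+1 ^+ k - z n ^+ k + k%:R * z n ^+ k.+1).
Proof.
have d2 : Oinv 2 (fun n => z n.+1 - z n).
  apply: (@Oinv_ext _ 1 _ (fun n => - (z n * z n.+1))).
    by move=> n n0; rewrite {2}inv_succB //; ring.
  exact: OinvN (OinvM (Oinv_z R) (Oinv_shift (Oinv_z R))).
elim: k => [|k IH].
  apply: (@Oinv_ext _ 0 _ (fun n => 0 * z n ^+ 2)) => [n _|].
    by rewrite !mul0r !expr0; ring.
  exact/OinvMl/Oinv_zX.
apply: (@Oinv_ext _ 1 _ (fun n => z n.+1 * (z n.+1 ^+ k - z n ^+ k + k%:R * z n ^+ k.+1)
  + (z n ^+ k.+1 * - (z n.+1 - z n) - (k%:R * z n ^+ k.+1) * (z n.+1 - z n)))).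
  move=> n n0; rewrite !exprS -[k.+1%:R]natr1.
  have d := inv_succB n0.
  have d' : z n ^+ k * (z n.+1 - z n + z n * z n.+1) = 0 by rewrite {1}d; ring.
  transitivity (z n.+1 * z n.+1 ^+ k - z n * z n ^+ k + (k%:R + 1) * (z n * (z n * z n ^+ k))
     - z n ^+ k * (z n.+1 - z n + z n * z n.+1)); first by ring.
  by rewrite d'; ring.
have IH' := OinvM (Oinv_shift (Oinv_z R)) IH.
apply: OinvD => //; apply: OinvB.
  by have := OinvM (Oinv_zX R k.+1) (OinvN d2); rewrite addn2.
by have := OinvM (OinvMl k%:R (Oinv_zX R k.+1)) d2; rewrite addn2.
Qed.

(** A bootstrap: [stirling_poly_shift] at [N = 0] gives order 1. At [N = 1] the linear terms then
    cancel up to order 2, since [z n.+1 - z n] and [(rho n - 1) * z n] both have that order. *)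
Lemma rho_approx : Oinv 2 (fun n => rho n - 1).
Proof.
have r1 : Oinv 1 (fun n => rho n - 1).
  apply: (@Oinv_ext _ 0 _ _ _ _ (OinvN (stirling_poly_shift 0))) => n _.
  by rewrite !horner_poly !big_ord1 !expr0 stirling_formula0; ring.
have := z_shift 1; have := stirling_poly_shift 1.
set b := stirling_formula R 1 => H1 H2.
apply: (@Oinv_ext _ 0 _ (fun n =>
  - ((stirling_poly 1).[z n.+1] - rho n * (stirling_poly 1).[z n])
  + b * (z n.+1 ^+ 1 - z n ^+ 1 + 1%:R * z n ^+ 2) - b * z n ^+ 2
  - b * ((rho n - 1) * z n))).
  move=> n _; rewrite !horner_poly !big_ord_recr !big_ord0 /= stirling_formula0 -/b.
  ring.
apply: OinvB; first apply: OinvB; first apply: OinvD.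
- exact: OinvN.
- by apply: OinvMl; exact: Oinv_le H2.
- exact/OinvMl/Oinv_zX.
- exact: OinvMl (OinvM r1 (Oinv_z R)).
Qed.

Lemma stirling_ratio_gt0 n : (0 < n)%N -> 0 < stirling_ratio R n.
Proof.
move=> n0; rewrite divr_gt0 ?ltr0n ?fact_gt0 //.
by rewrite !mulr_gt0 ?exprn_gt0 ?expR_gt0 ?sqrtr_gt0 ?mulr_gt0 ?pi_gt0 ?ltr0n.
Qed.

(* [stirling_ratio R n / (1 + K / n)] is eventually nondecreasing. *)
Lemma stirling_ratio_lower : exists2 c : R, 0 < c &
  exists n0, forall n, (n0 <= n)%N -> c <= stirling_ratio R n.
Proof.
(* Monotonicity of [s] reduces to [C (1 + K z) (1 + z) <= K]; beyond [n2] the product of the two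
   brackets is at most 2. *)
have [C C0 [n1 H]] := rho_approx; pose K := 2 * C + 1.
pose n2 := maxn 1 (maxn n1 (Num.truncn (1 + 2 * K)).+1).
pose s n := stirling_ratio R n / (1 + K * z n).
have K1 : 1 <= K by rewrite lerDr mulr_ge0.
have Kz n : 0 < 1 + K * z n.
  by rewrite ltr_wpDr // mulr_ge0 ?invr_ge0 // (le_trans _ K1).
have sS n : (n2 <= n)%N -> s n <= s n.+1.
  rewrite !geq_max => /and3P[n0 nn1 nt]; rewrite /s stirling_ratioS //.
  have r0 := stirling_ratio_gt0 n0.
  have z0 : 0 < z n by rewrite invr_gt0 ltr0n.
  have zS := inv_succ n0.
  have z1 : (1 + 2 * K) * z n <= 1.
    rewrite ler_pdivrMr ?ltr0n // mul1r ltW //; apply: lt_le_trans (truncnS_gt _) _.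
    by rewrite ler_nat.
  have z_le1 : z n <= 1 by nra.
  rewrite ler_pdivlMr // mulrAC ler_pdivrMr //.
  have -> : rho n * stirling_ratio R n * (1 + K * z n)
    = stirling_ratio R n * (rho n * (1 + K * z n)) by ring.
  rewrite ler_pM2l //.
  have := H n nn1; rewrite ler_norml => /andP[rl _].
  have rl' : 1 - C * z n ^+ 2 <= rho n by lra.
  apply: le_trans (_ : (1 - C * z n ^+ 2) * (1 + K * z n) <= _); last by rewrite ler_pM2r.
  rewrite zS -subr_ge0.
  have -> : (1 - C * z n ^+ 2) * (1 + K * z n) - (1 + K * (z n / (1 + z n)))
    = z n ^+ 2 / (1 + z n) * (K - C * (1 + K * z n) * (1 + z n)).
    by move: (z n) z0 => x x0; field; rewrite gt_eqF // addr_gt0.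
  apply: mulr_ge0; first by rewrite divr_ge0 ?exprn_ge0 ?addr_ge0 ?(ltW z0).
  have : (1 + K * z n) * (1 + z n) <= 2 by nra.
  have CK : C * 2 <= K by rewrite /K; lra.
  move=> K2; rewrite subr_ge0 -mulrA; apply: le_trans CK.
  by rewrite ler_wpM2l.
exists (s n2); first by rewrite divr_gt0 // stirling_ratio_gt0 // /n2; lia.
have s_mono m : s n2 <= s (n2 + m)%N.
  elim: m => [|m IH]; first by rewrite addn0.
  by rewrite addnS (le_trans IH) // sS // leq_addr.
exists n2 => n nn2; apply: le_trans (s_mono (n - n2)%N) _; rewrite subnKC //.
have r0 : 0 < stirling_ratio R n by rewrite stirling_ratio_gt0 //; rewrite /n2 in nn2; lia.
rewrite ler_pdivrMr //; apply: ler_peMr; first exact: ltW.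
by rewrite lerDl mulr_ge0 ?invr_ge0 // (le_trans _ K1).
Qed.

End StirlingRatio.

(** * Wallis' product and the limit of the Stirling ratio *)

Section Wallis.
Set Implicit Arguments.
Unset Strict Implicit.
Variable R : realType.

Local Notation z n := ((n%:R : R)^-1).

(** The primitive of [cos ^ n] vanishing at 0, given by the reduction formula, so that its value at
    [pi / 2] is the Wallis integral. *)
Fixpoint cosprim (n : nat) (x : R) : R :=
  match n with
  | 0 => x
  | m.+1 => match m with
    | 0 => sin x
    | k.+1 => m.+1%:R^-1 * (cos x ^+ m * sin x + m%:R * cosprim k x)
    end
  end.

Lemma cosprimSS n x :
  cosprim n.+2 x = n.+2%:R^-1 * (cos x ^+ n.+1 * sin x + n.+1%:R * cosprim n x).
Proof. by []. Qed.

Lemma is_derive_cosprim n (x : R) : is_derive x 1 (cosprim n) (cos x ^+ n).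
Proof.
suff : is_derive x 1 (cosprim n) (cos x ^+ n) /\
    is_derive x 1 (cosprim n.+1) (cos x ^+ n.+1) by case.
elim: n => [|n [IH1 IH2]].
  by split; [exact: is_derive_id|rewrite expr1; exact: is_derive_sin].
split; first exact: IH2.
have fE : cosprim n.+2 =
    n.+2%:R^-1 \*: (cos ^+ n.+1 * sin + n.+1%:R \*: cosprim n) :> (R -> R).
  by apply/funext => t; rewrite cosprimSS !fctE.
rewrite fE.
apply: (is_derive_eq (is_deriveZ _ (is_deriveD
  (is_deriveM (is_deriveX n.+1 (is_derive_cos x)) (is_derive_sin x))
  (is_deriveZ n.+1%:R IH1)))).
rewrite /GRing.scale /=.
have -> : (cos ^+ n.+1) x = cos x ^+ n.+1 by rewrite exprfctE.
have s2 := sin2cos2 x.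
transitivity (n.+2%:R^-1 * (cos x ^+ n.+1 * cos x + n.+1%:R * cos x ^+ n * (1 - sin x ^+ 2))).
  ring.
rewrite s2 !exprS -[n.+2%:R]natr1; field.
by rewrite nat1r natr1 pnatr_eq0.
Qed.

Definition wallis n := cosprim n (pi / 2).

Lemma wallisSS n : wallis n.+2 = n.+1%:R / n.+2%:R * wallis n.
Proof. by rewrite /wallis cosprimSS cos_pihalf expr0n mul0r add0r mulrA [_^-1 * _]mulrC. Qed.

Lemma wallis_nincr n : wallis n.+1 <= wallis n.
Proof.
have pi2 : 0 <= pi / 2 :> R by rewrite divr_ge0 ?pi_ge0.
have d (x : R) : is_derive x 1 (cosprim n - cosprim n.+1) (cos x ^+ n - cos x ^+ n.+1).
  exact: is_deriveB (is_derive_cosprim n x) (is_derive_cosprim n.+1 x).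
have [c /andP[c0 c1] E] := MVT_everywhere pi2 d.
have P0 k : cosprim k 0 = 0.
  suff : cosprim k 0 = 0 /\ cosprim k.+1 0 = 0 by case.
  elim: k => [|k [IH1 IH2]]; first by rewrite /= sin0.
  by split=> //; rewrite cosprimSS sin0 IH1 !mulr0 addr0 mulr0.
rewrite -subr_ge0; have -> : wallis n - wallis n.+1 =
    (cos c ^+ n - cos c ^+ n.+1) * (pi / 2 - 0).
  rewrite -E; transitivity (cosprim n (pi / 2) - cosprim n.+1 (pi / 2)
    - (cosprim n 0 - cosprim n.+1 0)); last by [].
  by rewrite !P0 subr0 subr0.
rewrite subr0 mulr_ge0 //.
have cos0 : 0 <= cos c.
  by apply: cos_ge0_pihalf; rewrite c1 andbT (le_trans _ c0) // oppr_le0.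
by rewrite exprS subr_ge0 ler_piMl ?exprn_ge0 //.
Qed.

(** The central binomial coefficient of [2n] divided by [4^n]. *)
Definition cbin n : R := (2 * n)`!%:R / (4 ^+ n * n`!%:R ^+ 2).

Lemma cbin_gt0 n : 0 < cbin n.
Proof. by rewrite divr_gt0 ?mulr_gt0 ?exprn_gt0 ?ltr0n ?fact_gt0. Qed.

Lemma cbinS n : cbin n.+1 = (2 * n).+1%:R / (2 * n).+2%:R * cbin n.
Proof.
rewrite /cbin mulnS !add2n !factS !natrM exprS.
have n1 : n%:R + 1 != 0 :> R by rewrite natr1 pnatr_eq0.
rewrite -![_.+1%:R]natr1 !natrM; field.
rewrite factR_neq0 expf_neq0 //= n1 /=.
by rewrite -natrM !natr1 pnatr_eq0.
Qed.

Lemma wallis_cbin n : wallis (2 * n) = pi / 2 * cbin n /\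
  wallis (2 * n).+1 = ((2 * n).+1%:R * cbin n)^-1.
Proof.
elim: n => [|n [IH1 IH2]].
  rewrite muln0 /cbin fact0 expr0 expr1n mulr1 divr1 mulr1 /wallis /= sin_pihalf.
  by rewrite mul1r invr1.
have c0 := lt0r_neq0 (cbin_gt0 n).
rewrite mulnS add2n !wallisSS IH1 IH2 cbinS; split; first by ring.
have n0 := ler0n R n.
by field; rewrite c0 !lt0r_neq0 //; lra.
Qed.

(** The monotonicity of [wallis] at [2n], [2n + 1], [2n + 2] encloses [pi * n * cbin n ^ 2] between
    [2n / (2n + 1)] and 1. *)
Lemma cbin_approx : Oinv 1 (fun n => pi * n%:R * cbin n ^+ 2 - 1).
Proof.
apply: (@Oinv_bound _ 1 _ _ (fun n => z n)); last exact: Oinv_z.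
move=> n n0; have [W0 W1] := wallis_cbin n.
have c0 := cbin_gt0 n; have p0 := pi_gt0 R.
have nR : 1 <= n%:R :> R by rewrite ler1n.
have H1 := wallis_nincr (2 * n).+1; have H2 := wallis_nincr (2 * n).
rewrite wallisSS W0 W1 in H1; rewrite W0 W1 in H2.
rewrite -[(2 * n).+2%:R]natr1 -[(2 * n).+1%:R]natr1 natrM in H1.
rewrite -[(2 * n).+1%:R]natr1 natrM in H2.
move: (cbin n) c0 H1 H2 => c c0; move: (n%:R : R) nR => x nR H1 H2.
have x1 : 0 < 2 * x + 1 by lra.
have x1c : 0 < (2 * x + 1) * c by rewrite mulr_gt0.
rewrite -[leRHS]div1r ler_pdivlMr // in H1.
rewrite -[leLHS]div1r ler_pdivrMr // in H2.
have v1 : 2 * x <= (pi * x * c ^+ 2) * (2 * x + 1) by rewrite expr2; nra.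
have H1' : pi * c ^+ 2 * (2 * x + 1) ^+ 2 <= 2 * (2 * x + 1 + 1).
  move: H1; rewrite -subr_ge0 => H1; rewrite -subr_ge0.
  suff -> : 2 * (2 * x + 1 + 1) - pi * c ^+ 2 * (2 * x + 1) ^+ 2 =
     (1 - (2 * x + 1) / (2 * x + 1 + 1) * (pi / 2 * c) * ((2 * x + 1) * c))
       * (2 * (2 * x + 1 + 1)).
    by rewrite mulr_ge0 //; lra.
  by field; rewrite gt_eqF //; lra.
have v0 : 0 < pi * x * c ^+ 2 by rewrite !mulr_gt0 ?exprn_gt0 //; lra.
have v2 : pi * x * c ^+ 2 <= 1.
  have : (pi * x * c ^+ 2) * (2 * x + 1) ^+ 2 <= x * (2 * (2 * x + 1 + 1)).
    have -> : (pi * x * c ^+ 2) * (2 * x + 1) ^+ 2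
        = x * (pi * c ^+ 2 * (2 * x + 1) ^+ 2) by ring.
    by rewrite ler_wpM2l //; lra.
  move: (pi * x * c ^+ 2) v0 => v v0; nra.
rewrite ler_norml; apply/andP; split; last first.
  by apply: le_trans (_ : 0 <= _); [lra|rewrite invr_ge0; lra].
move: (pi * x * c ^+ 2) v0 v1 v2 => v v0 v1 v2.
have xx : x * x^-1 = 1 by rewrite mulfV // gt_eqF //; lra.
have : 0 < x^-1 by rewrite invr_gt0; lra.
move: (x^-1) xx => y xy y0; nra.
Qed.

(** In [r(2n)^2 / r(n)^4] the exponentials cancel and the square roots disappear, which leaves the
    Wallis quantity. *)
Lemma stirling_ratio_double n : (0 < n)%N ->
  stirling_ratio R (2 * n) ^+ 2 = pi * n%:R * cbin n ^+ 2 * stirling_ratio R n ^+ 4.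
Proof.
move=> n0; have n0R : 0 < n%:R :> R by rewrite ltr0n.
have p0 := pi_gt0 R.
rewrite /stirling_ratio /cbin !expr_div_n !exprMn.
have -> : Num.sqrt (2 * pi * (2 * n)%:R) ^+ 2 = 4 * (pi * n%:R) :> R.
  by rewrite sqr_sqrtr ?mulr_ge0 // ?(ltW p0) // natrM; ring.
have -> : Num.sqrt (2 * pi * n%:R) ^+ 4 = 4 * (pi * n%:R) ^+ 2 :> R.
  by rewrite (exprM _ 2 2) sqr_sqrtr ?mulr_ge0 // ?(ltW p0) //; ring.
have -> : (2 * n)%:R ^+ (2 * n) = 4 ^+ n * (n%:R ^+ n) ^+ 2 :> R.
  rewrite natrM exprMn exprM; congr (_ ^+ _ * _); first by ring.
  by rewrite mulnC exprM.
have -> : expR (- (2 * n)%:R) = expR (- n%:R) ^+ 2 :> R.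
  by rewrite natrM -mulrN expRM_natl.
have A0 : n%:R ^+ n != 0 :> R by rewrite expf_neq0 // gt_eqF.
have E0 : expR (- n%:R) != 0 :> R by rewrite gt_eqF // expR_gt0.
have f0 := factR_neq0 R n.
have G0 : 4 ^+ n != 0 :> R by rewrite expf_neq0.
move: (pi : R) p0 => p p0.
move: (n%:R ^+ n) A0 (expR _) E0 (n`!%:R) f0 ((2 * n)`!%:R) (4 ^+ n) G0 => A A0 E E0 f f0 F G G0.
field.
by rewrite A0 E0 f0 G0 !gt_eqF.
Qed.

(** The limit of [stirling_ratio_double] gives [c^2 = c^4], and [stirling_ratio_lower] makes [c]
    positive. *)
Lemma stirling_ratio_limit (c : R) :
  Oinv 1 (fun n => stirling_ratio R n - c) -> c = 1.
Proof.
move=> rc.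
have c_gt0 : 0 < c.
  have [d d0 [n0 H]] := stirling_ratio_lower R; apply: lt_le_trans d0 _.
  rewrite leNgt; apply/negP => cd.
  have /Oinv1_cst0 : Oinv 1 (fun=> d - c).
    have [C C0 [n1 H1]] := rc; exists C => //; exists (maxn n0 n1) => n.
    rewrite geq_max => /andP[nn0 nn1]; apply: le_trans (H1 _ nn1).
    have dr := H _ nn0; rewrite !ger0_norm; lra.
  lra.
have r0 : Oinv 0 (stirling_ratio R).
  apply: (@Oinv_ext _ 0 _ (fun n => (stirling_ratio R n - c) + c)) => [n _|]; first by ring.
  by apply: OinvD; [exact: Oinv_le rc|exact: Oinv_cst].
have rc2 : Oinv 1 (fun n => stirling_ratio R n ^+ 2 - c ^+ 2).
  apply: (@Oinv_ext _ 0 _ (fun n =>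
    (stirling_ratio R n - c) * (stirling_ratio R n + c))) => [n _|]; first by ring.
  by apply: OinvMr => //; apply: OinvD => //; exact: Oinv_cst.
have r2 : Oinv 0 (fun n => stirling_ratio R n ^+ 2) := OinvM r0 r0.
have rc4 : Oinv 1 (fun n => stirling_ratio R n ^+ 4 - c ^+ 4).
  apply: (@Oinv_ext _ 0 _ (fun n =>
    (stirling_ratio R n ^+ 2 - c ^+ 2) * (stirling_ratio R n ^+ 2 + c ^+ 2))) => [n _|].
    by ring.
  by apply: OinvMr => //; apply: OinvD => //; exact: Oinv_cst.
have rd2 : Oinv 1 (fun n => stirling_ratio R (2 * n) ^+ 2 - c ^+ 2).
  have [C C0 [n0 H]] := rc2; exists C => //; exists (maxn 1 n0) => n.
  rewrite geq_max => /andP[n1 nn0]; apply: le_trans (H (2 * n)%N _) _; first by lia.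
  by rewrite ler_wpM2l // !expr1 lef_pV2 ?posrE ?ltr0n ?ler_nat; lia.
have : c ^+ 4 - c ^+ 2 = 0.
  apply: Oinv1_cst0; apply: (@Oinv_ext _ 1 _ (fun n =>
    (stirling_ratio R (2 * n) ^+ 2 - c ^+ 2) - (stirling_ratio R n ^+ 4 - c ^+ 4)
    - (pi * n%:R * cbin n ^+ 2 - 1) * stirling_ratio R n ^+ 4)).
    by move=> n n0; rewrite stirling_ratio_double //; ring.
  apply: OinvB; first exact: OinvB.
  apply: OinvMr; first exact: cbin_approx.
  by apply: (@Oinv_ext _ 0 _ _ _ _ (OinvM r2 r2)) => n _; ring.
have -> : c ^+ 4 - c ^+ 2 = c ^+ 2 * (c + 1) * (c - 1) by ring.
have c2 : c ^+ 2 * (c + 1) != 0 by rewrite gt_eqF // mulr_gt0 ?exprn_gt0 ?addr_gt0.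
by move/eqP; rewrite mulf_eq0 (negbTE c2) subr_eq0 => /eqP.
Qed.

End Wallis.

(** * Uniqueness of the coefficients *)

Section Uniqueness.
Set Implicit Arguments.
Unset Strict Implicit.
Variable R : realType.

Local Notation z n := ((n%:R : R)^-1).

Lemma stirling_coefficientsP (a : nat -> R) : stirling_coefficients a ->
  forall N, Oinv N.+1 (fun n => stirling_ratio R n - (\poly_(k < N.+1) a k).[z n]).
Proof.
move=> ha N; have /eqO_exP[C C0 [n0 _ H]] := ha N.
exists C; first exact: ltW.
exists n0 => n nn0; have := H n nn0; rewrite /= -exprVn.
rewrite [X in _ <= C * X]ger0_norm ?exprn_ge0 ?invr_ge0 // horner_poly.
by under eq_bigr do rewrite -exprVn.
Qed.

Lemma Oinv_cancel m (c : R) : Oinv m.+1 (fun n => c * z n ^+ m) -> c = 0.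
Proof.
move=> [C C0 [n0 H]]; apply: Oinv1_cst0; exists C => //; exists (maxn 1 n0) => n.
rewrite geq_max => /andP[n1 nn0]; have := H n nn0.
have zm : 0 < z n ^+ m by rewrite exprn_gt0 // invr_gt0 ltr0n.
by rewrite normrM [`|_ ^+ m|]gtr0_norm // exprSr mulrA mulrAC ler_pM2r.
Qed.

(** The expansion inherits the functional equation from [stirling_ratioS], because [rho] is
    bounded. *)
Lemma poly_trunc_shift (a : nat -> R) N :
  Oinv N.+1 (fun n => stirling_ratio R n - (\poly_(k < N.+1) a k).[z n]) ->
  Oinv N.+1 (fun n => (\poly_(k < N.+1) a k).[z n.+1]
    - rho R n * (\poly_(k < N.+1) a k).[z n]).
Proof.
move=> Oa; set A := \poly_(k < N.+1) a k in Oa *.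
apply: (@Oinv_ext _ 1 _ (fun n => (stirling_ratio R n - A.[z n]) * rho R n
   - (stirling_ratio R n.+1 - A.[z n.+1]))).
  by move=> n n0; rewrite stirling_ratioS //; ring.
by apply: OinvB; [apply: OinvMr => //; exact: Oinv_rho|exact: (Oinv_shift Oa)].
Qed.

Lemma stirling_coefficients_formula (a : nat -> R) :
  stirling_coefficients a -> forall k, a k = stirling_formula R k.
Proof.
move=> ha; have Oa := stirling_coefficientsP ha.
elim/ltn_ind => -[_|k IH].
  rewrite stirling_formula0; apply: stirling_ratio_limit.
  by apply: (@Oinv_ext _ 0 _ _ _ _ (Oa 0)) => n _; rewrite horner_poly big_ord1 mulr1.
pose d i := a i - stirling_formula R i.
(* The difference of two consecutive values loses one order, so [d k.+1] shows up at order [k + 2];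
   one further coefficient is kept to push the error to order [k + 3]. *)
pose D : {poly R} := \poly_(i < k.+3) d i.
have D_eval n : D.[z n] = d k.+1 * z n ^+ k.+1 + d k.+2 * z n ^+ k.+2.
  rewrite horner_poly big_ord_recr big_ord_recr /= big1 ?add0r // => i _.
  by rewrite /d IH ?subrr ?mul0r.
have D_shift : Oinv k.+3 (fun n => D.[z n.+1] - D.[z n]).
  have DE n : D.[z n] = (\poly_(i < k.+3) a i).[z n] - (stirling_poly R k.+2).[z n].
    by rewrite !horner_poly -sumrB; apply: eq_bigr => i _; rewrite mulrBl.
  apply: (@Oinv_ext _ 0 _ (fun n =>
    ((\poly_(i < k.+3) a i).[z n.+1] - rho R n * (\poly_(i < k.+3) a i).[z n])
    - ((stirling_poly R k.+2).[z n.+1] - rho R n * (stirling_poly R k.+2).[z n])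
    + (rho R n - 1) * D.[z n])).
    by move=> n _; rewrite !DE; ring.
  apply: OinvD.
    by apply: OinvB; [exact: poly_trunc_shift|exact: stirling_poly_shift].
  have := @OinvM _ 2 k.+1 _ (fun n => D.[z n]) (rho_approx R); rewrite add2n; apply.
  apply: (@Oinv_ext _ 0 _ (fun n => d k.+1 * z n ^+ k.+1 + d k.+2 * z n ^+ k.+2)).
    by move=> n _; rewrite D_eval.
  by apply: OinvD; apply: OinvMl; [exact: Oinv_zX|exact: Oinv_le (Oinv_zX R k.+2)].
(* By [z_shift] the difference [D.[z n.+1] - D.[z n]] has leading term
   [- (k + 1) * d k.+1 * z n ^+ k.+2], whereas [D_shift] makes it smaller. *)
have : k.+1%:R * d k.+1 = 0.
  apply: (@Oinv_cancel k.+2).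
  apply: (@Oinv_ext _ 0 _ (fun n =>
     d k.+1 * (z n.+1 ^+ k.+1 - z n ^+ k.+1 + k.+1%:R * z n ^+ k.+2)
     + d k.+2 * ((z n.+1 ^+ k.+2 - z n ^+ k.+2 + k.+2%:R * z n ^+ k.+3)
         - k.+2%:R * z n ^+ k.+3)
     - (D.[z n.+1] - D.[z n]))).
    by move=> n _; rewrite !D_eval; ring.
  apply: OinvB => //; apply: OinvD; apply: OinvMl; first exact: z_shift.
  apply: OinvB; first exact: Oinv_le (z_shift R k.+2).
  exact/OinvMl/Oinv_zX.
by move/eqP; rewrite mulf_eq0 pnatr_eq0 /= subr_eq0 => /eqP.
Qed.

End Uniqueness.

Theorem theorem2p1 (R : realType) (a : nat -> R)
    (ha : stirling_coefficients a) (k : nat) :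
  a k = (2 * k)`!%:R / (2 ^+ k * k`!%:R) *
    \sum_(i < (2 * k).+1)
      gbinom (k%:R + i%:R - 1 / 2) i * gbinom (3 * k%:R + 1 / 2) (2 * k - i) *
      2 ^+ i *
      \sum_(j < i.+1)
        'C(i, j)%:R * (-1) ^+ j * j`!%:R *
        ((stirling2 (2 * k + i + j) j)%:R / (2 * k + i + j)`!%:R).
Proof. exact: stirling_coefficients_formula. Qed.
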